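(* Let $k\geq 3$ be a square-free integer. Then \[ \left\{A\in \mathbb{A}\cap [e^{-e},e^{1/e}] : h(A) \text{ is algebraic and } \mathrm{ord}(A)=k\right\}=\left\{\left(\frac{k}{s}\right)^{\frac{s}{k}}: s\in\mathbb{N},\ k/e\leq s\leq ke,\ \gcd(s,k)=1\right\}. \]
   Context: $\mathbb{A}$ denotes the set of algebraic numbers. For a real $x\in[e^{-e},e^{1/e}]$, the sequence $x,\ x^x,\ x^{x^x},\ldots$ converges; its limit is denoted $h(x)$. It satisfies $h(x)=x^{h(x)}$ and $1/e\leq h(x)\leq e$. For an algebraic number $A$, $\mathrm{ord}(A):=\min\{n\in\mathbb{N}: A^n\in\mathbb{Q}\}$ if such $n$ exists, and $\mathrm{ord}(A)=\infty$ otherwise. *)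

(* Defs.v *)
From Stdlib Require Import Reals Lra Lia ZArith Arith List Znumtheory.
Open Scope R_scope.

Definition zpoly_eval (l : list Z) (x : R) : R :=
  fold_right (fun c acc => IZR c + x * acc) 0 l.

Definition is_algebraic (x : R) : Prop :=
  exists l : list Z, (exists c, In c l /\ c <> 0%Z) /\ zpoly_eval l x = 0.

Definition is_rational (x : R) : Prop :=
  exists p q : Z, q <> 0%Z /\ x = IZR p / IZR q.

Fixpoint tower (x : R) (n : nat) : R :=
  match n with
  | O => x
  | S m => Rpower x (tower x m)
  end.

Definition ord_eq (A : R) (k : nat) : Prop :=
  (1 <= k)%nat /\ is_rational (A ^ k) /\
  (forall n : nat, (1 <= n)%nat -> (n < k)%nat -> ~ is_rational (A ^ n)).

Definition squarefree (k : nat) : Prop :=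
  forall p : Z, prime p -> ~ (p * p | Z.of_nat k)%Z.

(* Main.v *)
(** The limit h of the tower satisfies h = A^h, so r = A^k is rational and r^h = h^k is
    algebraic: by the Gelfond-Schneider theorem h is rational. Writing h = m/n in lowest
    terms, A^m = (m/n)^n; minimality of k gives m = kt, and coprimality makes m = kt a
    t-th power, which for k squarefree and at least 3 forces t = 1, i.e. m = k.
    Conversely A = h^(1/h) with 1/e <= h <= e makes the tower converge to h.

    The case of Gelfond-Schneider needed here is special: r, h and r^h all lie in Q(h).
    It is proved with an interpolation determinant. The functions x^p r^(qx) (p < T^3,
    q < T) are evaluated at the L = T^4 points i + jh (i, j < T^2). The determinant D is
    nonzero by Rolle's theorem, since the points are distinct when h is irrational. Up to
    a denominator it lies in Z[ch] for an algebraic integer ch, so a Liouville inequality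
    bounds log|D| from below by -C T^7 log T. Newton's divided differences bound it from
    above by -(1/2) T^8 log T + O(T^8), a contradiction for large T. *)

Require Import Defs.
From Stdlib Require Import Reals Lra Lia ZArith Arith List Znumtheory Classical.
From mathcomp Require all_boot all_order fingroup perm all_algebra.
From mathcomp Require Rstruct ring lra zify.
Open Scope R_scope.

(** * Power towers *)

(** All estimates stay in R and Z, without complex analysis or conjugates of h. For Liouville,
    integer polynomials in g = c * h are evaluated at the companion matrix G of the minimal
    polynomial of g: det U(G) is the norm of U(g), an integer, and a norm of U(G) replaces the sizes
    of the conjugates. For the upper bound, a divided difference divides a coefficient norm by rho -
    X, which is what Schwarz's lemma does on discs.

    The parameters are balanced as follows. There are T^3 * T functions and T^2 * T^2 points, both L
    = T^4. The points lie in an interval of length X of order T^2, and rho of order T^3 makes X /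
    (rho - X) equal to 1/T. Per column, rho^(T^3) costs O(T^3 log T) and exp (|c0| * rho)^T costs
    O(T^4); the arithmetic of an entry costs O(T^3 log T); the gain is (L/2) log T on average, which
    wins by a factor log T. Both bounds are written as L-th powers, so the final comparison takes an
    L-th root and needs no logarithm. *)

Lemma continuity_pt_expM (l x : R) : continuity_pt (fun y => exp (y * l)) x.
Proof. apply derivable_continuous_pt. reg. Qed.

Lemma Un_cv_constant (a : R) : Un_cv (fun _ => a) a.
Proof. intros eps Heps. exists 0%nat. intros n _. now rewrite Rdist_eq. Qed.

Lemma Un_cv_succ (u : nat -> R) (l : R) : Un_cv u l -> Un_cv (fun n => u (S n)) l.
Proof.
  intros H eps Heps. destruct (H eps Heps) as [N HN]. exists N.
  intros n Hn. apply HN. lia.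
Qed.

Lemma Un_cv_even_odd (u : nat -> R) (l : R) :
  Un_cv (fun n => u (2 * n)%nat) l -> Un_cv (fun n => u (S (2 * n))) l -> Un_cv u l.
Proof.
  intros H0 H1 eps Heps.
  destruct (H0 eps Heps) as [N0 HN0]. destruct (H1 eps Heps) as [N1 HN1].
  exists (2 * (N0 + N1))%nat. intros n Hn.
  destruct (Nat.Even_or_Odd n) as [[m ->] | [m ->]].
  - apply HN0. lia.
  - replace (2 * m + 1)%nat with (S (2 * m)) by lia. apply HN1. lia.
Qed.

Lemma tower_succ (A : R) (n : nat) : tower A (S n) = exp (tower A n * ln A).
Proof. reflexivity. Qed.

Lemma tower_pos (A : R) (n : nat) : 0 < A -> 0 < tower A n.
Proof. intros HA. destruct n as [|n]; [exact HA | apply exp_pos]. Qed.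

Lemma tower_limit_fixpoint (A h : R) :
  Un_cv (tower A) h -> h = exp (h * ln A).
Proof.
  intros H. apply (UL_sequence (fun n => tower A (S n))).
  - now apply Un_cv_succ.
  - exact (continuity_seq _ _ _ (continuity_pt_expM (ln A) h) H).
Qed.

Lemma exp_mono (x y : R) : x <= y -> exp x <= exp y.
Proof.
  intros [H | ->]; [left; now apply exp_increasing | right; reflexivity].
Qed.

Lemma ln_mono (x y : R) : 0 < x -> x <= y -> ln x <= ln y.
Proof. intros Hx [H | ->]; [left; now apply ln_increasing | right; reflexivity]. Qed.

Lemma exp1_gt1 : 1 < exp 1.
Proof. pose proof (exp_ineq1 1 ltac:(lra)). lra. Qed.

(** With ln A <= 1/e, x <= e implies A^x <= exp (e/e) = e, so e bounds every stage of the tower. *)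
Lemma tower_limit_le_e (A h : R) :
  0 < A -> ln A <= / exp 1 -> Un_cv (tower A) h -> h <= exp 1.
Proof.
  intros HA Hl Hcv. pose proof exp1_gt1 as He.
  apply (@Rle_cv_lim (tower A) (fun _ => exp 1)); [|exact Hcv|apply Un_cv_constant].
  induction n as [|n IH].
  - simpl. rewrite <- (exp_ln A HA). apply exp_mono.
    apply Rle_trans with (/ exp 1); [exact Hl|].
    apply Rmult_le_reg_r with (exp 1); [lra|]. rewrite Rinv_l; lra.
  - rewrite tower_succ. apply exp_mono.
    pose proof (tower_pos A n HA) as Ht.
    apply Rle_trans with (tower A n * / exp 1).
    + apply Rmult_le_compat_l; lra.
    + apply Rmult_le_reg_r with (exp 1); [lra|].
      rewrite Rmult_assoc, Rinv_l, Rmult_1_r, Rmult_1_l; lra.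
Qed.

(** If h < 1/e, then h * l >= - e * h > -1, and h = exp (h * l) would exceed 1/e. *)
Lemma fixpoint_ge_inv_e (l h : R) :
  - exp 1 <= l -> h = exp (h * l) -> / exp 1 <= h.
Proof.
  intros Hl Hh. pose proof exp1_gt1 as He.
  destruct (Rle_or_lt (/ exp 1) h) as [H | H]; [exact H|exfalso].
  assert (0 < h) by (rewrite Hh; apply exp_pos).
  assert (h * exp 1 < 1).
  { apply Rmult_lt_compat_r with (r := exp 1) in H; [|lra].
    rewrite Rinv_l in H; lra. }
  assert (H2 : exp (- (1)) < h).
  { rewrite Hh. apply exp_increasing. nra. }
  rewrite exp_Ropp in H2. lra.
Qed.

(** The inequality exp u >= 1 + u at u = ln h - 1. For A = h^(1/h) it yields ln A <= 1/e. *)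
Lemma ln_le_div_e (h : R) : 0 < h -> ln h <= h * / exp 1.
Proof.
  intros Hh. pose proof exp1_gt1 as He.
  assert (0 < h * / exp 1) by (apply Rmult_lt_0_compat; [lra|apply Rinv_0_lt_compat; lra]).
  assert (E : exp (ln h) = exp 1 * (h * / exp 1)) by (rewrite exp_ln by lra; field; lra).
  destruct (Rle_or_lt (ln h) (h * / exp 1)) as [H1 | H1]; [exact H1|exfalso].
  pose proof (exp_ineq1_le (ln h - 1)) as H2.
  unfold Rminus in H2. rewrite exp_plus, exp_Ropp, E in H2.
  rewrite (Rmult_comm (exp 1)), Rmult_assoc, Rinv_r, Rmult_1_r in H2; lra.
Qed.

(** By the mean value theorem l = 1/z for some z between x and y, so ln y = y * l > 1, against y <=
    e. Above e a second fixed point of x -> A^x can exist, hence the bound. *)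
Lemma log_ratio_inj (l x y : R) :
  0 < x -> x < y -> y <= exp 1 -> ln x = x * l -> ln y = y * l -> False.
Proof.
  intros Hx Hxy Hy Ex Ey.
  destruct (MVT_cor2 (fun z => ln z - z * l) (fun z => / z - 1 * l) x y Hxy)
    as [z [Hz [Hz1 Hz2]]].
  { intros z Hz. apply derivable_pt_lim_minus.
    - apply derivable_pt_lim_ln. lra.
    - apply (derivable_pt_lim_scal_right id z 1 l). apply derivable_pt_lim_id. }
  rewrite Ex, Ey in Hz.
  assert (Hl : / z = l) by nra.
  assert (ln y <= 1) by (rewrite <- (ln_exp 1); apply ln_mono; lra).
  assert (z * l = 1) by (rewrite <- Hl; apply Rinv_r; lra).
  assert (0 < l) by (rewrite <- Hl; apply Rinv_0_lt_compat; lra).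
  nra.
Qed.

Lemma tower_cv_ge1 (A h : R) :
  1 <= A -> h <= exp 1 -> h = exp (h * ln A) -> Un_cv (tower A) h.
Proof.
  intros HA He Hh.
  assert (HA0 : 0 < A) by lra.
  assert (Hl : 0 <= ln A) by (rewrite <- ln_1; apply ln_mono; lra).
  assert (Hh0 : 0 < h) by (rewrite Hh; apply exp_pos).
  assert (Hh1 : 1 <= h) by (rewrite Hh, <- exp_0; apply exp_mono; nra).
  assert (Hle : forall n, tower A n <= h).
  { induction n as [|n IH].
    - simpl. rewrite Hh. rewrite <- (exp_ln A HA0) at 1. apply exp_mono. nra.
    - rewrite tower_succ, Hh. apply exp_mono. apply Rmult_le_compat_r; lra. }
  assert (Hgrow : Un_growing (tower A)).
  { intros n. induction n as [|n IH].
    - rewrite tower_succ. simpl. rewrite <- (exp_ln A HA0) at 1. apply exp_mono. nra.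
    - rewrite (tower_succ A n), (tower_succ A (S n)). apply exp_mono.
      apply Rmult_le_compat_r; lra. }
  destruct (growing_cv (tower A) Hgrow) as [L HL].
  { exists h. intros x [n ->]. apply Hle. }
  pose proof (tower_limit_fixpoint A L HL) as EL.
  assert (L <= h).
  { apply (@Rle_cv_lim (tower A) (fun _ => h)); auto using Un_cv_constant. }
  destruct (Req_dec L h) as [<- | Hne]; [exact HL|exfalso].
  apply (log_ratio_inj (ln A) L h); [|lra|lra| |].
  - rewrite EL. apply exp_pos.
  - rewrite EL at 1. apply ln_exp.
  - rewrite Hh at 1. apply ln_exp.
Qed.

(* With y = exp (- c x), the derivative c^2 y exp (- c y) of the double step is at
   most c / e <= 1, with equality only at c = e and x = 1 / e. *)
Lemma double_step_fixpoint_unique (c h L : R) :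
  0 < c <= exp 1 -> / exp 1 <= h -> h = exp (h * - c) ->
  L = exp (exp (L * - c) * - c) -> L = h.
Proof.
  intros [Hc0 Hce] Hhe Hh HL. pose proof exp1_gt1 as He.
  set (psi := fun x => exp (exp (x * - c) * - c)).
  set (dpsi := fun x => c * c * exp (x * - c) * exp (exp (x * - c) * - c)).
  assert (Dpsi : forall x, derivable_pt_lim psi x (dpsi x)).
  { intros x. unfold psi, dpsi.
    assert (Din : forall g g' y, derivable_pt_lim g y g' ->
      derivable_pt_lim (fun z => exp (g z * - c)) y (exp (g y * - c) * (g' * - c))).
    { intros g g' y Hg.
      apply (derivable_pt_lim_comp (fun z => g z * - c) exp).
      - now apply derivable_pt_lim_scal_right.
      - apply derivable_pt_lim_exp. }
    replace (c * c * exp (x * - c) * exp (exp (x * - c) * - c))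
      with (exp (exp (x * - c) * - c) * (exp (x * - c) * (1 * - c) * - c)) by ring.
    apply (Din (fun z => exp (z * - c))).
    apply (Din id). apply derivable_pt_lim_id. }
  assert (Hcontr : forall x, x <> h -> dpsi x < 1).
  { intros x Hx. unfold dpsi. set (y := exp (x * - c)).
    assert (Hy : 0 < y) by apply exp_pos.
    destruct (Req_dec (c * y) 1) as [Hcy | Hcy].
    - assert (E : exp (y * - c) = / exp 1).
      { replace (y * - c) with (- (1)) by lra. now rewrite exp_Ropp. }
      rewrite E. replace (c * c * y * / exp 1) with (c * (c * y) * / exp 1) by ring.
      rewrite Hcy, Rmult_1_r.
      apply Rmult_lt_reg_r with (exp 1); [lra|].
      rewrite Rmult_assoc, Rinv_l, Rmult_1_r, Rmult_1_l by lra.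
      (* With c = e the hypotheses pin h down: h >= 1/e gives h = exp (- e * h) <= 1/e. Derivative 1
         would make x = 1/e = h as well. *)
      destruct Hce as [Hce | Hce]; [exact Hce|exfalso].
      assert (Ex : x * - c = - (1)).
      { apply exp_inv. fold y. rewrite exp_Ropp, <- Hce.
        apply Rmult_eq_reg_l with c; [|lra]. rewrite Rinv_r; lra. }
      assert (Hch : 1 <= h * c).
      { rewrite Hce. apply Rmult_le_compat_r with (r := exp 1) in Hhe; [|lra].
        rewrite Rinv_l in Hhe; lra. }
      assert (Hh2 : h <= / exp 1).
      { rewrite Hh, <- exp_Ropp. apply exp_mono. lra. }
      apply Hx. apply Rmult_eq_reg_r with c; [|lra].
      assert (h = / exp 1) as -> by lra. rewrite <- Hce, Rinv_l; lra.
    - pose proof (exp_ineq1 (c * y - 1) ltac:(lra)) as H1.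
      assert (E : exp (c * y - 1) * exp (y * - c) = / exp 1).
      { rewrite <- exp_plus, <- exp_Ropp. f_equal. ring. }
      pose proof (exp_pos (y * - c)) as H2.
      assert (H3 : c * y * exp (y * - c) < / exp 1) by nra.
      assert (H4 : c * / exp 1 <= 1).
      { apply Rmult_le_reg_r with (exp 1); [lra|].
        rewrite Rmult_assoc, Rinv_l, Rmult_1_r, Rmult_1_l; lra. }
      nra. }
  assert (Eh : psi h = h) by (unfold psi; now rewrite <- Hh, <- Hh).
  assert (EL : psi L = L) by (symmetry; exact HL).
  destruct (Rtotal_order L h) as [H | [H | H]]; [|exact H|]; exfalso.
  - destruct (MVT_cor2 psi dpsi L h H (fun z _ => Dpsi z)) as [z [Hz Hzr]].
    pose proof (Hcontr z ltac:(lra)). rewrite Eh, EL in Hz. nra.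
  - destruct (MVT_cor2 psi dpsi h L H (fun z _ => Dpsi z)) as [z [Hz Hzr]].
    pose proof (Hcontr z ltac:(lra)). rewrite Eh, EL in Hz. nra.
Qed.

(** An increasing f preserves the order of the first two terms, so the sequence is monotone in one
    direction or the other. *)
Lemma increasing_iteration_cv (f : R -> R) (u : nat -> R) (m M : R) :
  (forall x y, x <= y -> f x <= f y) -> (forall n, u (S n) = f (u n)) ->
  (forall n, m <= u n <= M) -> exists L, Un_cv u L.
Proof.
  intros Hf Hu Hb.
  destruct (Rle_or_lt (u 0%nat) (u 1%nat)) as [H | H].
  - destruct (growing_cv u) as [L HL]; [| |now exists L].
    + intros n. induction n as [|n IH]; [exact H|].
      rewrite (Hu n), (Hu (S n)). now apply Hf.
    + exists M. intros x [n ->]. apply Hb.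
  - destruct (decreasing_cv u) as [L HL]; [| |now exists L].
    + intros n. induction n as [|n IH]; [lra|].
      rewrite (Hu n), (Hu (S n)). now apply Hf.
    + exists (- m). intros x [n ->]. unfold opp_seq. specialize (Hb n). lra.
Qed.

(** For A < 1 the map x -> A^x is decreasing, but the double step is increasing: the even terms
    converge to a fixed point of it, which is h by [double_step_fixpoint_unique], and the odd terms
    follow by continuity. *)
Lemma tower_cv_lt1 (A h : R) :
  0 < A < 1 -> - exp 1 <= ln A -> / exp 1 <= h -> h = exp (h * ln A) ->
  Un_cv (tower A) h.
Proof.
  intros [HA0 HA1] Hl Hhe Hh.
  assert (Hl0 : ln A < 0) by (rewrite <- ln_1; apply ln_increasing; lra).
  assert (Hb : forall n, 0 <= tower A n <= 1).
  { intros n. split; [left; now apply tower_pos|].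
    destruct n as [|n]; [simpl; lra|].
    rewrite tower_succ, <- exp_0. apply exp_mono.
    pose proof (tower_pos A n HA0). nra. }
  assert (Hcv : Un_cv (fun n => tower A (2 * n)%nat) h).
  { set (v := fun n => tower A (2 * n)%nat).
    assert (Hv : forall n, v (S n) = exp (exp (v n * ln A) * ln A)).
    { intros n. unfold v. replace (2 * S n)%nat with (S (S (2 * n))) by lia.
      now rewrite !tower_succ. }
    destruct (increasing_iteration_cv (fun x => exp (exp (x * ln A) * ln A)) v 0 1)
      as [L HL]; [|exact Hv|intros n; apply Hb|].
    - intros x y Hxy. apply exp_mono.
      assert (exp (y * ln A) <= exp (x * ln A)) by (apply exp_mono; nra). nra.
    - assert (L = h) as <-; [|exact HL].
      apply (double_step_fixpoint_unique (- ln A)); rewrite ?Ropp_involutive; auto; [lra|].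
      apply (UL_sequence (fun n => v (S n))); [now apply Un_cv_succ|].
      apply Un_cv_ext with (fun n => exp (exp (v n * ln A) * ln A)); [now intros n; rewrite Hv|].
      apply (continuity_seq (fun y => exp (y * ln A)) (fun n => exp (v n * ln A))).
      + apply continuity_pt_expM.
      + exact (continuity_seq _ _ _ (continuity_pt_expM (ln A) L) HL). }
  apply Un_cv_even_odd; [exact Hcv|].
  rewrite Hh at 1.
  exact (continuity_seq _ _ _ (continuity_pt_expM (ln A) h) Hcv).
Qed.

(** * The real Gelfond-Schneider theorem *)

(* A module confines the MathComp notations, which would otherwise change how the
   theorem is parsed. *)
Module GelfondSchneider.
Import all_boot all_order fingroup perm all_algebra.
Import Rstruct ring lra zify.
Set Implicit Arguments. Unset Strict Implicit. Unset Printing Implicit Defensive.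
Import Order.TTheory GRing.Theory Num.Theory.
Local Open Scope ring_scope.

(** * A submultiplicative norm on matrices *)

Definition mxnorm (R : numDomainType) m n (A : 'M[R]_(m, n)) : R :=
  \sum_i \sum_j `|A i j|.

Lemma mxnorm_ge0 (R : numDomainType) m n (A : 'M[R]_(m, n)) : 0 <= mxnorm A.
Proof. by apply: sumr_ge0 => i _; apply: sumr_ge0. Qed.

Lemma entry_le_mxnorm (R : numDomainType) m n (A : 'M[R]_(m, n)) i j :
  `|A i j| <= mxnorm A.
Proof.
rewrite /mxnorm (bigD1 i) //= (bigD1 j) //= -addrA lerDl addr_ge0 ?sumr_ge0 //.
by move=> k _; apply: sumr_ge0.
Qed.

Lemma mxnormD (R : numDomainType) m n (A B : 'M[R]_(m, n)) :
  mxnorm (A + B) <= mxnorm A + mxnorm B.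
Proof.
rewrite /mxnorm -big_split; apply: ler_sum => i _.
by rewrite -big_split; apply: ler_sum => j _; rewrite mxE ler_normD.
Qed.

Lemma mxnormM (R : numDomainType) m n p (A : 'M[R]_(m, n)) (B : 'M[R]_(n, p)) :
  mxnorm (A *m B) <= mxnorm A * mxnorm B.
Proof.
rewrite /mxnorm mulr_suml; apply: ler_sum => i _.
apply: (@le_trans _ _ (\sum_j \sum_k `|A i k| * `|B k j|)).
  apply: ler_sum => j _; rewrite mxE (le_trans (ler_norm_sum _ _ _)) //.
  by apply: ler_sum => k _; rewrite normrM.
rewrite exchange_big /= mulr_suml; apply: ler_sum => k _.
rewrite -mulr_sumr ler_wpM2l // (bigD1 k) //= lerDl sumr_ge0 // => l _.
exact: sumr_ge0.
Qed.

Lemma mxnorm_scalar (R : numDomainType) n (a : R) :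
  mxnorm (a%:M : 'M_n) = `|a| *+ n.
Proof.
rewrite /mxnorm (eq_bigr (fun=> `|a|)) ?sumr_const ?card_ord // => i _.
rewrite (bigD1 i) //= big1 ?mxE ?eqxx ?mulr1n ?addr0 // => j ne.
by rewrite mxE eq_sym (negPf ne) mulr0n normr0.
Qed.

(** The factor [n.+1] is the norm of the identity, the case k = 0. Summing all entries keeps the
    norm submultiplicative and integral on integer matrices. *)
Lemma mxnormX (R : numDomainType) n (A : 'M[R]_n.+1) k :
  mxnorm (A ^+ k) <= n.+1%:R * mxnorm A ^+ k.
Proof.
elim: k => [|k IH]; first by rewrite expr0 mxnorm_scalar normr1 expr0 mulr1.
rewrite !exprS mulrCA (le_trans (mxnormM _ _)) //.
by rewrite ler_wpM2l ?mxnorm_ge0.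
Qed.

Lemma mxnorm_sum (R : numDomainType) m n I (r : seq I) (P : pred I)
    (F : I -> 'M[R]_(m, n)) :
  mxnorm (\sum_(i <- r | P i) F i) <= \sum_(i <- r | P i) mxnorm (F i).
Proof.
elim/big_ind2: _ => // [|A x B y hA hB].
  by rewrite /mxnorm big1 // => i _; rewrite big1 // => j _; rewrite mxE normr0.
by rewrite (le_trans (mxnormD _ _)) ?lerD.
Qed.

Lemma mxnorm_prod (R : numDomainType) n I (r : seq I)
    (F : I -> 'M[R]_n.+1) (e : R) : (forall i, mxnorm (F i) <= e) ->
  mxnorm (\prod_(i <- r) F i) <= n.+1%:R * e ^+ size r.
Proof.
move=> he; elim: r => [|i r IH].
  by rewrite big_nil mxnorm_scalar normr1 mulr1.
rewrite big_cons /= exprS mulrCA (le_trans (mxnormM _ _)) //.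
by rewrite ler_pM ?mxnorm_ge0.
Qed.

(** [horner_mx G] is a ring morphism, so the Leibniz formula for the polynomial matrix carries over:
    L! products of L matrices of norm at most e. *)
Lemma mxnorm_horner_det (R : numDomainType) n L (G : 'M[R]_n.+1)
    (E : 'M[{poly R}]_L) (e : R) :
  (forall i j, mxnorm (horner_mx G (E i j)) <= e) ->
  mxnorm (horner_mx G (\det E)) <= n.+1%:R * (L`!)%:R * e ^+ L.
Proof.
move=> he; rewrite /determinant rmorph_sum (le_trans (mxnorm_sum _ _ _)) //.
have -> : n.+1%:R * (L`!)%:R * e ^+ L = \sum_(s : {perm 'I_L}) n.+1%:R * e ^+ L.
  by rewrite sumr_const card_Sn mulrAC mulr_natr.
apply: ler_sum => s _; rewrite rmorphM rmorphXn rmorphN1 rmorph_prod.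
have -> : forall B : 'M[R]_n.+1, mxnorm ((-1) ^+ s * B) = mxnorm B.
  move=> B.
  rewrite -signr_odd; case: (odd s) => /=; rewrite ?expr0 ?mul1r //.
  rewrite expr1 mulN1r; apply: eq_bigr => i _; apply: eq_bigr => j _.
  by rewrite mxE normrN.
have := @mxnorm_prod R n _ (index_enum 'I_L) (fun i => horner_mx G (E i (s i))) e.
by rewrite /= -[index_enum _]enumT size_enum_ord; apply.
Qed.

Lemma det_norm_le (R : numDomainType) n (A : 'M[R]_n) (e : 'I_n -> R) :
  (forall i j, `|A i j| <= e i) -> `|\det A| <= (n`!)%:R * \prod_i e i.
Proof.
move=> he; rewrite /determinant (le_trans (ler_norm_sum _ _ _)) //.
have -> : (n`!)%:R * \prod_i e i = \sum_(s : {perm 'I_n}) \prod_i e i.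
  by rewrite sumr_const card_Sn mulr_natl.
apply: ler_sum => s _; rewrite normrM normrX normrN1 expr1n mul1r normr_prod.
by apply: ler_prod => i _; rewrite normr_ge0 he.
Qed.

Lemma horner_mx_eigenvector (F : fieldType) n (A : 'M[F]_n.+1) (v : 'rV_n.+1)
    (a : F) (p : {poly F}) :
  v *m A = a *: v -> v *m horner_mx A p = p.[a] *: v.
Proof.
move=> hv; elim/poly_ind: p => [|p c IH].
  by rewrite rmorph0 mulmx0 horner0 scale0r.
rewrite rmorphD rmorphM /= horner_mx_X horner_mx_C mulmxDr hornerMXaddC.
by rewrite mulmxA IH -scalemxAl hv scalerA mul_mx_scalar -scalerDl.
Qed.

(** The dimension of [companionmx q] is computed from [size q]; the existential restates it as
    [n.+1], the form that [horner_mx] expects. *)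
Lemma exists_companion (R : comNzRingType) n (q : {poly R}) :
  q \is monic -> size q = n.+2 -> exists G : 'M[R]_n.+1, char_poly G = q.
Proof.
move=> mq sq; have := companionmxK mq; move: (companionmx q); rewrite sq /=.
by move=> G; exists G.
Qed.

(** * Liouville inequality through an integer matrix *)

Section Liouville.
Variables (R : realFieldType) (g : R) (n : nat) (q : {poly int}).
Hypothesis q_monic : q \is monic.
Hypothesis size_q : size q = n.+2.
Hypothesis q_root : root (map_poly intr q) g.
Hypothesis q_min : forall s : {poly rat},
  s != 0 -> root (map_poly ratr s) g -> (n.+2 <= size s)%N.
Variable G : 'M[int]_n.+1.
Hypothesis char_G : char_poly G = q.

Let toQ (p : {poly int}) : {poly rat} := map_poly intr p.

Let map_toQ p : map_poly (ratr : rat -> R) (toQ p) = map_poly intr p.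
Proof. by rewrite -map_poly_comp; apply: eq_map_poly => x /=; rewrite ratr_int. Qed.

(** The gcd divides U, so it does not vanish at g. Its cofactor in q therefore does, and by
    minimality has the size of q; the gcd is constant. *)
Lemma coprime_min_poly U : (map_poly intr U).[g] != 0 :> R ->
  coprimep (toQ U) (toQ q).
Proof.
move=> Ug; rewrite coprimep_def.
have qn0 : toQ q != 0.
  by rewrite map_poly_eq0_id0 ?monic_neq0 // (monicP q_monic) oner_neq0.
have sq : size (toQ q) = n.+2.
  by rewrite size_map_poly_id0 ?size_q // (monicP q_monic) oner_neq0.
have /dvdpP[s qE] := dvdp_gcdr (toQ U) (toQ q).
have /dvdpP[t UE] := dvdp_gcdl (toQ U) (toQ q).
set d := gcdp _ _ in qE UE *.
have sn0 : s != 0 by apply: contraNneq qn0 => s0; rewrite qE s0 mul0r.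
have dn0 : d != 0 by apply: contraNneq qn0 => s0; rewrite qE s0 mulr0.
have rs : root (map_poly ratr s) g.
  move: q_root; rewrite -map_toQ qE rmorphM rootM => /orP[] // rd.
  case/negP: Ug; rewrite -map_toQ UE rmorphM hornerM.
  by rewrite (rootP rd) mulr0.
have := q_min sn0 rs; rewrite -sq qE size_mul // => le_size.
move: sn0 dn0 le_size; rewrite -!size_poly_gt0.
case: (size s) => // a; case: (size d) => // b _ _.
by rewrite addSn addnS /= ltnS -[leqRHS]addn0 leq_add2l leqn0 eqSS.
Qed.

(** A Bezout relation u * U + v * q = c with c a nonzero rational becomes u(G) * U(G) = c at G,
    since q(G) = 0 by Cayley-Hamilton; take determinants. *)
Lemma det_horner_neq0 U : (map_poly intr U).[g] != 0 :> R ->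
  \det (horner_mx G U) != 0.
Proof.
move=> /coprime_min_poly/Bezout_coprimepP[[u v] /= uv1].
pose GQ := map_mx (intr : int -> rat) G.
have E p : map_mx intr (horner_mx G p) = horner_mx GQ (toQ p).
  by rewrite map_horner_mx.
have q0 : horner_mx GQ (toQ q) = 0.
  by rewrite -E -char_G Cayley_Hamilton map_mx0.
move: uv1; rewrite -size_poly_eq1 => /size_poly1P[c cn0 uvc].
have := congr1 (horner_mx GQ) uvc.
rewrite rmorphD !rmorphM /= q0 mulr0 addr0 horner_mx_C => /(congr1 determinant).
rewrite det_mulmx det_scalar => Hdet; apply: contra_neq (expf_neq0 n.+1 cn0) => d0.
by rewrite -Hdet -E det_map_mx d0 rmorph0 mulr0.
Qed.

(* A left eigenvector v of G for g gives U(g) v adj(U(G)) = det(U(G)) v, where det(U(G)) is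
   a nonzero integer. *)
Lemma liouville : exists2 K : R, 0 < K & forall U : {poly int},
  (map_poly intr U).[g] != 0 :> R ->
  1 <= K * `|(map_poly intr U).[g]| * (mxnorm (horner_mx G U))%:~R ^+ n.
Proof.
pose GR := map_mx (intr : int -> R) G.
have : root (char_poly GR) g by rewrite -map_char_poly char_G.
rewrite -eigenvalue_root_char => /eigenvalueP[v vG vn0].
have /rV0Pn[j vj] := vn0.
(* n! N^n bounds the entries of the adjugate, which are n x n minors; the quotient comes from
   comparing the entries of index j in the identity between vectors. *)
exists (mxnorm v / `|v 0 j| * (n`!)%:R).
  rewrite mulr_gt0 ?ltr0n ?fact_gt0 // divr_gt0 ?normr_gt0 //.
  by rewrite (lt_le_trans _ (entry_le_mxnorm v 0 j)) ?normr_gt0.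
move=> U Ug; set M := horner_mx G U; set N := (mxnorm M)%:~R.
have E : map_mx intr M = horner_mx GR (map_poly intr U) by rewrite map_horner_mx.
have vM := horner_mx_eigenvector (map_poly intr U) vG.
set u := (map_poly intr U).[g] in Ug vM *.
have eqv : u *: (v *m \adj (map_mx intr M)) = (\det M)%:~R *: v.
  by rewrite scalemxAl -vM -E -mulmxA mul_mx_adj mul_mx_scalar det_map_mx.
have adjle i k : `|(\adj (map_mx intr M : 'M[R]_n.+1)) i k| <= (n`!)%:R * N ^+ n.
  rewrite mxE /cofactor normrM normrX normrN1 expr1n mul1r.
  rewrite -[n in N ^+ n]card_ord -prodr_const.
  apply: det_norm_le => a b; rewrite !mxE -intr_norm ler_int.
  exact: entry_le_mxnorm.
have d1 : 1 <= `|(\det M)%:~R| :> R.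
  by rewrite -intr_norm ler1z -gtz0_ge1 normr_gt0 det_horner_neq0.
have := congr1 (fun w : 'rV_n.+1 => w 0 j) eqv; rewrite /= 3!mxE => eqj.
have le1 : `|v 0 j| <= `|u| * (mxnorm v * ((n`!)%:R * N ^+ n)).
  rewrite -[leLHS]mul1r (le_trans (ler_wpM2r _ d1)) // -normrM.
  rewrite -eqj normrM ler_wpM2l //.
  rewrite (le_trans (ler_norm_sum _ _ _)) // /mxnorm big_ord1 mulr_suml.
  by apply: ler_sum => i _; rewrite normrM ler_wpM2l.
rewrite -(@ler_pM2l _ `|v 0 j|) ?normr_gt0 // mulr1 (le_trans le1) //.
have vj0 : `|v 0 j| != 0 by rewrite normr_eq0.
by rewrite le_eqVlt; apply/orP; left; apply/eqP; field.
Qed.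
End Liouville.

(** * Newton interpolation and an upper bound for determinants *)

Section NewtonInterpolation.
Variable R : realFieldType.
Implicit Types (s : seq R) (x y rho : R) (u : nat -> R).

(* A sequence is read as the polynomial with these coefficients; trailing zeros are
   harmless. *)
Definition heval s x : R := foldr (fun c a => c + x * a) 0 s.
Definition hnorm s rho : R := foldr (fun c a => `|c| + rho * a) 0 s.

(** The quotient of s(y) - s(x) by y - x, from y s'(y) - x s'(x) = (y - x) s'(x) + y (s'(y) -
    s'(x)), where s' is the tail of s. *)
Fixpoint ddiff x s : seq R :=
  if s is _ :: s' then heval s' x :: ddiff x s' else [::].

Lemma heval_ddiff x y s : heval s y = heval s x + (y - x) * heval (ddiff x s) y.
Proof.
elim: s => [|c s IH] /=; first by rewrite mulr0 addr0.
by rewrite [in LHS]IH; ring.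
Qed.

Lemma hnorm_ge0 s rho : 0 <= rho -> 0 <= hnorm s rho.
Proof. by move=> h; elim: s => //= c s IH; rewrite addr_ge0 ?mulr_ge0. Qed.

Lemma heval_le_hnorm s x rho : 0 <= x <= rho -> `|heval s x| <= hnorm s rho.
Proof.
case/andP=> x0 xr; elim: s => [|c s IH] /=; first by rewrite normr0.
rewrite (le_trans (ler_normD _ _)) // lerD2l normrM (ger0_norm x0).
exact: ler_pM.
Qed.

(** For nonnegative coefficients this is the equality [heval_ddiff] at y = rho. Dropping [hnorm s x]
    leaves the gain 1 / (rho - x) of each divided difference. *)
Lemma hnorm_ddiff s x rho : 0 <= x <= rho ->
  (rho - x) * hnorm (ddiff x s) rho <= hnorm s rho - hnorm s x.
Proof.
case/andP=> x0 xr; elim: s => [|c s IH] /=; first by rewrite mulr0 subrr.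
have le1 : `|heval s x| <= hnorm s x by apply: heval_le_hnorm; rewrite x0 lexx.
have -> : `|c| + rho * hnorm s rho - (`|c| + x * hnorm s x)
   = (rho - x) * hnorm s x + rho * (hnorm s rho - hnorm s x) by ring.
rewrite mulrDr lerD ?ler_wpM2l ?subr_ge0 // mulrCA ler_wpM2l //.
exact: le_trans xr.
Qed.

Fixpoint newton u s n : seq R :=
  if n is n'.+1 then ddiff (u n') (newton u s n') else s.

Lemma hnorm_newton u s n X rho : (forall i, 0 <= u i <= X) -> X < rho ->
  hnorm (newton u s n) rho <= hnorm s rho / (rho - X) ^+ n.
Proof.
move=> hu Xr; have d0 : 0 < rho - X by rewrite subr_gt0.
have r0 : 0 <= rho.
  by case/andP: (hu 0%N) => a b; rewrite (le_trans a) // (le_trans b) // ltW.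
elim: n => [|n IH] /=; first by rewrite expr0 divr1.
rewrite exprS invfM mulrCA mulrC ler_pdivlMr // mulrC.
apply: le_trans IH; case/andP: (hu n) => a b.
have c : u n <= rho by rewrite (le_trans b) // ltW.
apply: (@le_trans _ _ ((rho - u n) * hnorm (ddiff (u n) (newton u s n)) rho)).
  by rewrite ler_wpM2r ?hnorm_ge0 // lerD2l lerN2.
rewrite (le_trans (hnorm_ddiff _ _)) ?a ?c // gerBl.
exact: hnorm_ge0.
Qed.

Lemma newton_expansion u s y n :
  heval s y = \sum_(i < n) heval (newton u s i) (u i) * \prod_(j < i) (y - u j)
            + heval (newton u s n) y * \prod_(j < n) (y - u j).
Proof.
elim: n => [|n IH]; first by rewrite !big_ord0 add0r mulr1.
rewrite big_ord_recr /= -addrA IH; congr (_ + _).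
by rewrite big_ord_recr /= [in LHS](heval_ddiff (u n)); ring.
Qed.

(* Newton's expansion factors the matrix as a lower triangular one, with diagonal
   \prod_(j < l) (u l - u j), times that of divided differences. *)
Lemma interpolation_det_le u (f : nat -> seq R) L X rho F :
  (forall i, 0 <= u i <= X) -> X < rho ->
  (forall m, (m < L)%N -> hnorm (f m) rho <= F) ->
  `|\det (\matrix_(l < L, m < L) heval (f m) (u l))|
    <= (L`!)%:R * \prod_(n < L) (F * (X / (rho - X)) ^+ n).
Proof.
move=> hu Xr hF; have d0 : 0 < rho - X by rewrite subr_gt0.
pose W : 'M[R]_L := \matrix_(l, n) \prod_(j < n) (u l - u j).
pose C : 'M[R]_L := \matrix_(n, m) heval (newton u (f m) n) (u n).
have -> : \matrix_(l < L, m < L) heval (f m) (u l) = W *m C.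
  apply/matrixP => l m; rewrite !mxE (newton_expansion u _ _ L).
  (* u l is one of the L nodes, so the remainder of the expansion vanishes there. *)
  rewrite [X in _ + _ * X](bigD1 l) //= subrr mul0r mulr0 addr0.
  by apply: eq_bigr => n _; rewrite !mxE mulrC.
have trigW : is_trig_mx W.
  apply/is_trig_mxP => i j ij; rewrite mxE.
  by rewrite (bigD1 (Ordinal ij)) //= subrr mul0r.
have leW : `|\det W| <= \prod_(n < L) X ^+ n.
  rewrite (det_trig trigW) normr_prod; apply: ler_prod => n _.
  rewrite normr_ge0 mxE normr_prod -[n in X ^+ n]card_ord -prodr_const.
  apply: ler_prod => j _; rewrite normr_ge0 /= ler_norml.
  case/andP: (hu n) => a b; case/andP: (hu j) => c d.
  by apply/andP; split; lra.
have leC : `|\det C| <= (L`!)%:R * \prod_(n < L) (F / (rho - X) ^+ n).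
  apply: det_norm_le => n m; rewrite mxE.
  apply: (@le_trans _ _ (hnorm (newton u (f m) n) rho)).
    apply: heval_le_hnorm; case/andP: (hu n) => -> b.
    by rewrite (le_trans b) // ltW.
  rewrite (le_trans (hnorm_newton _ _ hu Xr)) //.
  by rewrite ler_wpM2r ?hF // invr_ge0 exprn_ge0 // ltW.
rewrite det_mulmx normrM (le_trans (ler_pM _ _ leW leC)) //.
rewrite mulrCA -big_split /= ler_wpM2l // le_eqVlt; apply/orP; left; apply/eqP.
apply: eq_bigr => n _; rewrite expr_div_n; ring.
Qed.

End NewtonInterpolation.

(** * Zeros of exponential polynomials *)

Section ExpPoly.
Variable c : R.
Hypothesis c_neq0 : c != 0.
Implicit Types (l : seq {poly R}) (x a : R).

Definition exppoly l x : R :=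
  foldr (fun (p : {poly R}) acc => p.[x] + exp (c * x)%R * acc) 0 l.

Lemma exppoly_mkseq (f : nat -> {poly R}) n x :
  exppoly (mkseq f n) x = \sum_(q < n) (f q).[x] * exp (c * x)%R ^+ q.
Proof.
rewrite /mkseq; elim: n f => [|n IH] f; first by rewrite big_ord0.
rewrite big_ord_recl expr0 mulr1 /=; congr (_ + _).
rewrite (iotaDl 1 0 n) -map_comp IH mulr_sumr; apply: eq_bigr => i _.
by rewrite /= exprS add1n; ring.
Qed.

(* [exppoly (dexppoly a l)] is f' + a f for f = [exppoly l]. *)
Fixpoint dexppoly a l : seq {poly R} :=
  if l is p :: l' then (p^`() + a *: p) :: dexppoly (a + c)%R l' else [::].

Lemma derivable_pt_lim_horner (p : {poly R}) x :
  derivable_pt_lim (fun y => p.[y]) x (p^`()).[x].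
Proof.
elim/poly_ind: p => [|p b IH].
  rewrite deriv0 horner0; have := derivable_pt_lim_const 0 x.
  apply: derivable_pt_lim_ext => y; exact/esym/horner0.
have := derivable_pt_lim_plus _ _ _ _ _
  (derivable_pt_lim_mult _ _ _ _ _ IH (derivable_pt_lim_id x))
  (derivable_pt_lim_const b x).
rewrite derivD derivM derivX derivC addr0 hornerD !hornerM hornerX hornerC.
rewrite /id RplusE !RmultE -[IZR 0]/(0 : R) -[IZR 1]/(1 : R) addr0 => H.
by apply: (derivable_pt_lim_ext _ _ _ _ _ H) => y; rewrite hornerMXaddC.
Qed.

Lemma derivable_pt_lim_expM x :
  derivable_pt_lim (fun y => exp (c * y)%R) x (c * exp (c * x)%R)%R.
Proof.
have := derivable_pt_lim_comp (fun y : R => c * y) exp x c (exp (c * x)%R).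
rewrite [c * exp _]mulrC; apply; last exact: derivable_pt_lim_exp.
have := derivable_pt_lim_scal id c x 1 (derivable_pt_lim_id x).
by rewrite RmultE mulr1.
Qed.

Lemma derivable_pt_lim_exppoly a l x :
  derivable_pt_lim (exppoly l) x (exppoly (dexppoly a l) x - a * exppoly l x)%R.
Proof.
elim: l a => [|p l IH] a /=.
  by rewrite mulr0 subr0; exact: derivable_pt_lim_const.
have := derivable_pt_lim_plus _ _ _ _ _ (derivable_pt_lim_horner p x)
  (derivable_pt_lim_mult _ _ _ _ _ (derivable_pt_lim_expM x) (IH (a + c)%R)).
rewrite !RplusE !RmultE; congr derivable_pt_lim.
by rewrite hornerD hornerZ; ring.
Qed.

(** Keeping the starting point x in the conclusion is what lets the induction prepend the Rolle
    point d, which lies below y. *)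
Lemma rolle_path (f f' : R -> R) x z :
  (forall y, derivable_pt_lim f y (f' y)) ->
  path <%R x z -> all (fun y => f y == 0) (x :: z) ->
  exists z', [/\ size z' = size z, path <%R x z' & all (fun y => f' y == 0) z'].
Proof.
move=> df; elim: z x => [|y z IH] x /=; first by exists [::].
case/andP=> xy pz /andP[/eqP fx fz].
have [z' [sz' pz' f'z']] := IH y pz fz; case/andP: fz => /eqP fy _.
have [d [Hd [/RltP xd /RltP dy]]] : exists d, (f y - f x = f' d * (y - x)) /\
    (Rlt x d /\ Rlt d y).
  by have [d [H ?]] := MVT_cor2 f f' x y (elimT RltP xy) (fun b _ => df b); exists d.
exists (d :: z'); rewrite /= sz' xd f'z' andbT; split=> //.
  by apply: (path_le _ dy pz') => ? ? ?; exact: lt_trans.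
move: Hd; rewrite fx fy subrr => /esym/eqP; rewrite mulf_eq0 => /orP[] //.
by rewrite subr_eq0 gt_eqF.
Qed.

(** The number of available coefficients, which exceeds the number of real zeros unless all
    coefficients vanish. *)
Definition weight l := (\sum_(p <- l) size p)%N.

Lemma weight_dexppoly a l : (weight (dexppoly a l) <= weight l)%N.
Proof.
rewrite /weight; elim: l a => [|p l IH] a /=; first by rewrite !big_nil.
rewrite !big_cons leq_add //; have [->|p0] := eqVneq p 0.
  by rewrite deriv0 scaler0 addr0.
rewrite (leq_trans (size_polyD _ _)) // geq_max size_scale_leq andbT.
by rewrite ltnW ?lt_size_deriv.
Qed.

Lemma size_dexppoly a l : size (dexppoly a l) = size l.
Proof. by elim: l a => //= p l IH a; rewrite IH. Qed.

Lemma derivDZ_eq0 a (p : {poly R}) : a != 0 -> p^`() + a *: p = 0 -> p = 0.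
Proof.
move=> a0 H; apply/eqP; apply: contraT => p0.
move/eqP: H; rewrite -size_poly_eq0 addrC size_polyDl; last first.
  by rewrite size_scale // lt_size_deriv.
by rewrite size_scale // size_poly_eq0 (negPf p0).
Qed.

Lemma dexppoly_eq0 a l : (forall n : nat, a + c *+ n != 0) ->
  all (fun p => p == 0) (dexppoly a l) -> all (fun p => p == 0) l.
Proof.
elim: l a => //= p l IH a ha /andP[/eqP p0 l0].
apply/andP; split; first by apply/eqP/(@derivDZ_eq0 a) => //; have := ha 0%N; rewrite addr0.
by apply: IH l0 => n; have := ha n.+1; rewrite mulrS addrA.
Qed.

Lemma deriv_eq0_const (p : {poly R}) : p^`() = 0 -> p = (p`_0)%:P.
Proof.
move=> dp; apply/polyP => -[|i]; rewrite coefC //=.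
have /eqP := congr1 (fun q : {poly R} => q`_i) dp.
by rewrite coef_deriv coef0 mulrn_eq0 /= => /eqP.
Qed.

(* Rolle's theorem: differentiation loses one zero and decreases the weight by one, as
   long as the coefficient of the constant exponential is nonzero; if it is zero, divide
   by [exp (c * x)]. *)
Lemma exppoly_zeros l z : sorted <%R z -> all (fun x => exppoly l x == 0) z ->
  (weight l <= size z)%N -> all (fun p => p == 0) l.
Proof.
have [n] := ubnP (size l + weight l); elim: n l z => // n IH [|p l] z //.
rewrite {1 2}/weight big_cons -/(weight l) [size (p :: l)]/= => ltn sz az wz.
have [p0|p0] := eqVneq p 0.
  rewrite /= p0 eqxx /=; apply: (IH l z) => //.
  - by move: ltn; rewrite p0 size_poly0 add0n addSn ltnS.
  - apply: sub_all az => x; rewrite /= p0 horner0 add0r mulf_eq0 => /orP[] //.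
    by move=> /eqP H; have := exp_pos (c * x); rewrite H => /Rlt_irrefl.
  - by move: wz; rewrite p0 size_poly0 add0n.
case: z sz az wz => [|x z] sz az wz.
  by move: wz; rewrite leqn0 addn_eq0 size_poly_eq0 (negPf p0).
have df y : derivable_pt_lim (exppoly (p :: l)) y (exppoly (dexppoly 0%R (p :: l)) y).
  by have := derivable_pt_lim_exppoly 0%R (p :: l) y; rewrite mul0r subr0.
have [z' [sz' pz' az']] := rolle_path df sz az.
have ltw : (weight (dexppoly 0%R (p :: l)) < size p + weight l)%N.
  rewrite /weight /= big_cons scale0r addr0 -addSn leq_add ?lt_size_deriv //.
  exact: weight_dexppoly.
have sd : size (dexppoly 0%R (p :: l)) = (size l).+1.
  exact: size_dexppoly.
have h1 : ((size l).+1 + weight (dexppoly 0%R (p :: l)) < n)%N.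
  by rewrite -ltnS (leq_trans _ ltn) // ltnS ltn_add2l.
have h2 : (weight (dexppoly 0%R (p :: l)) <= size z')%N.
  by rewrite sz' -ltnS (leq_trans ltw).
have := IH (dexppoly 0%R (p :: l)) z'; rewrite sd => /(_ h1 (path_sorted pz') az' h2) /=.
case/andP; rewrite scale0r addr0 => /eqP/deriv_eq0_const pc.
move=> /dexppoly_eq0 l0; have {}l0 : all (fun q => q == 0) l.
  by apply: l0 => m; rewrite add0r -mulrS mulrn_eq0.
(* Only the constant p is left, and it takes the value 0 at x. *)
exfalso; have exp0 : exppoly l x = 0.
  elim: l l0 {IH ltn sz az wz df z' sz' pz' az' ltw sd h1 h2} => //= q l IH.
  by case/andP=> /eqP-> /IH ->; rewrite horner0 mulr0 addr0.
case/andP: az => /=; rewrite exp0 mulr0 addr0 pc hornerC => /eqP p00 _.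
by move: p0; rewrite pc p00 polyC0 eqxx.
Qed.

(** A linear relation between the columns is an exponential polynomial of weight at most P * Q that
    vanishes at P * Q distinct points. Column m stands for the exponents m mod P of x and m div P of
    exp (c x). *)
Lemma interpolation_det_neq0 (u : nat -> R) P Q : (0 < P)%N ->
  (forall i j, (i < P * Q)%N -> (j < P * Q)%N -> u i = u j -> i = j) ->
  \det (\matrix_(l < P * Q, m < P * Q)
          (u l ^+ (m %% P) * exp (c * u l)%R ^+ (m %/ P))) != 0.
Proof.
move=> P0 inj_u; set A := \matrix_(l, m) _; rewrite -det_tr.
apply/negP=> /det0P[v vn0 vA].
pose pol q : {poly R} := \sum_(m < P * Q | (m %/ P)%N == q) v 0 m *: 'X^(m %% P).
pose l := mkseq pol Q; pose z := sort <=%R [seq u i | i <- iota 0 (P * Q)].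
have lE x : exppoly l x = \sum_(m < P * Q) v 0 m * (x ^+ (m %% P) * exp (c * x)%R ^+ (m %/ P)).
  have mQ (m : 'I_(P * Q)) : (m %/ P < Q)%N by rewrite ltn_divLR // [(Q * P)%N]mulnC.
  transitivity (\sum_(q < Q) (pol q).[x] * exp (c * x)%R ^+ q).
    exact: exppoly_mkseq.
  rewrite [RHS](partition_big (fun m : 'I__ => Ordinal (mQ m)) xpredT) //=.
  apply: eq_bigr => q _; rewrite horner_sum mulr_suml; apply: eq_big => [m|m /eqP <-].
    by rewrite -val_eqE.
  by rewrite hornerZ hornerXn mulrA.
have sz : sorted <%R z.
  rewrite sort_lt_sorted map_inj_in_uniq ?iota_uniq // => i j.
  by rewrite !mem_iota !add0n /=; exact: inj_u.
have az : all (fun x => exppoly l x == 0) z.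
  rewrite all_sort all_map; apply/allP => i; rewrite mem_iota add0n /= => li.
  rewrite lE; have := congr1 (fun w : 'rV_(P * Q) => w 0 (Ordinal li)) vA.
  rewrite !mxE => H; apply/eqP; rewrite -[RHS]H.
  by apply: eq_bigr => m _; rewrite !mxE.
have wz : (weight l <= size z)%N.
  rewrite size_sort size_map size_iota /weight big_map.
  have -> : (P * Q = \sum_(q <- iota 0 Q) P)%N.
    by rewrite big_const_seq count_predT size_iota iter_addn_0.
  apply: leq_sum => q _; rewrite (leq_trans (size_sum _ _ _)) //.
  apply/bigmax_leqP => m _; rewrite (leq_trans (size_scale_leq _ _)) //.
  by rewrite size_polyXn ltn_mod.
have /allP l0 := exppoly_zeros sz az wz.
case/negP: vn0; apply/eqP/rowP => m; rewrite mxE.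
have mQ : (m %/ P < Q)%N by rewrite ltn_divLR // [(Q * P)%N]mulnC.
have /l0/eqP/(congr1 (fun p : {poly R} => p`_(m %% P))) : pol (m %/ P)%N \in l.
  by apply/mapP; exists (m %/ P)%N; rewrite ?mem_iota.
rewrite coef0 coef_sum (bigD1 m) //= coefZ coefXn eqxx mulr1 big1 ?addr0 //.
move=> m' /andP[/eqP mq mm']; rewrite coefZ coefXn.
case: eqP => [e|]; last by rewrite mulr0.
case/eqP: mm'; apply: val_inj.
by rewrite /= (divn_eq m P) (divn_eq m' P) mq e.
Qed.
End ExpPoly.

(** * Taylor truncation: from polynomials to exponentials *)

Lemma Un_cv_big (I : Type) (r : seq I) (idx : R) (op : R -> R -> R)
    (F : nat -> I -> R) (G : I -> R) :
  (forall f g a b, Un_cv f a -> Un_cv g b -> Un_cv (fun n => op (f n) (g n)) (op a b)) ->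
  (forall i, Un_cv (F^~ i) (G i)) ->
  Un_cv (fun n => \big[op/idx]_(i <- r) F n i) (\big[op/idx]_(i <- r) G i).
Proof.
move=> hop hF; elim: r => [|i r IH].
  rewrite big_nil; apply: Un_cv_ext (Un_cv_constant idx) => n; by rewrite big_nil.
rewrite big_cons; apply: Un_cv_ext (hop _ _ _ _ (hF i) IH) => n.
by rewrite big_cons.
Qed.

Lemma Un_cv_det n (M : nat -> 'M[R]_n) (A : 'M[R]_n) :
  (forall i j, Un_cv (fun N => M N i j) (A i j)) ->
  Un_cv (fun N => \det (M N)) (\det A).
Proof.
move=> h; apply: Un_cv_big => [|s]; first exact: CV_plus.
apply: (CV_mult _ _ _ _ (Un_cv_constant _)).
by apply: Un_cv_big => [|i]; [exact: CV_mult | exact: h].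
Qed.

(* Coefficients of x^p times the Taylor polynomial of exp (a x). *)
Definition exp_seq p (a : R) N : seq R :=
  nseq p 0 ++ mkseq (fun k => a ^+ k / (k`!)%:R) N.+1.

Lemma heval_exp_seq p a N x :
  heval (exp_seq p a N) x = x ^+ p * E1 (a * x)%R N.
Proof.
rewrite /exp_seq; elim: p => [|p IH]; last by rewrite /= add0r IH exprS mulrA.
rewrite expr0 mul1r /E1 sum_f_R0E big_mkord cat0s.
have H f n : heval (mkseq f n) x = \sum_(k < n) f k * x ^+ k.
  elim: n f => [|n IH'] f; first by rewrite big_ord0.
  rewrite /mkseq big_ord_recl expr0 mulr1 /=; congr (_ + _).
  rewrite (iotaDl 1 0 n) -map_comp IH' mulr_sumr; apply: eq_bigr => i _.
  by rewrite /= exprS add1n; ring.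
rewrite H; apply: eq_bigr => k _.
by rewrite RmultE RinvE RpowE INRE factE exprMn; ring.
Qed.

Lemma E1_le_exp x n : 0 <= x -> E1 x n <= exp x.
Proof.
move=> x0; apply/RleP; apply: growing_ineq (E1_cvg x) n => n.
rewrite /E1 tech5; apply/RleP; rewrite RplusE lerDl RmultE RinvE INRE RpowE.
by rewrite mulr_ge0 ?invr_ge0 ?exprn_ge0.
Qed.

Lemma exp_natM (x : R) n : exp (n%:R * x)%R = exp x ^+ n.
Proof. by rewrite expRX mulr_natl. Qed.

Lemma hnorm_exp_seq p a N rho : 0 <= rho ->
  hnorm (exp_seq p a N) rho <= rho ^+ p * exp (`|a| * rho)%R.
Proof.
move=> r0; have -> : hnorm (exp_seq p a N) rho = heval (exp_seq p `|a| N) rho.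
  rewrite /exp_seq; elim: p => [|p IH]; last by rewrite /= normr0 IH.
  have H k : `|a ^+ k / (k`!)%:R| = `|a| ^+ k / (k`!)%:R.
    by rewrite normrM normrX normfV normr_nat.
  by rewrite /mkseq; elim: (iota 0 N.+1) => //= k s ->; rewrite H.
by rewrite heval_exp_seq ler_wpM2l ?exprn_ge0 // E1_le_exp // mulr_ge0.
Qed.

(** [interpolation_det_le] is applied to Taylor truncations, whose norms have a bound independent of
    N, and the determinants converge. Since rho >= 1, the exponents m mod P and m div P may be
    raised to P and Q. *)
Lemma exp_interpolation_det_le (c : R) (u : nat -> R) P Q X rho :
  (0 < P)%N -> (forall i, 0 <= u i <= X) -> X < rho -> 1 <= rho ->
  `|\det (\matrix_(l < P * Q, m < P * Q)
          (u l ^+ (m %% P) * exp (c * u l)%R ^+ (m %/ P)))|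
  <= ((P * Q)`!)%:R * \prod_(n < P * Q)
       (rho ^+ P * exp (`|c| * rho)%R ^+ Q * (X / (rho - X)) ^+ n).
Proof.
move=> P0 hu Xr r1; set A := \matrix_(l, m) _; set B := (X in _ <= X).
have r0 : 0 <= rho by rewrite (le_trans ler01).
pose f N m := exp_seq (m %% P) ((m %/ P)%:R * c) N.
pose M N : 'M[R]_(P * Q) := \matrix_(l, m) heval (f N m) (u l).
have cvM i j : Un_cv (fun N => M N i j) (A i j).
  rewrite mxE -exp_natM.
  apply: (@Un_cv_ext (fun N => u i ^+ (j %% P) * E1 ((j %/ P)%:R * (c * u i))%R N)).
    by move=> N; rewrite mxE heval_exp_seq mulrA.
  by apply: CV_mult (Un_cv_constant _) _; exact: E1_cvg.
have /cv_cvabs cvD := Un_cv_det cvM.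
apply/RleP; rewrite -RabsE; apply: Rle_cv_lim cvD (Un_cv_constant B) => N.
rewrite RabsE; apply/RleP; apply: interpolation_det_le => // m mL.
have mQ : (m %/ P < Q)%N by rewrite ltn_divLR // [(Q * P)%N]mulnC.
rewrite (le_trans (hnorm_exp_seq _ _ _ r0)) // ler_pM ?exprn_ge0 //.
- exact/RleP/Rlt_le/exp_pos.
- by rewrite ler_weXn2l // ltnW // ltn_mod.
rewrite normrM normr_nat -mulrA exp_natM.
apply: ler_weXn2l; last exact: ltnW.
have := exp_ineq1_le (`|c| * rho)%R => /RleP; apply: le_trans.
by rewrite RplusE lerDl mulr_ge0.
Qed.

(** * Integral multiples of algebraic numbers *)

Lemma exists_min_size (F : nzRingType) (S : {poly F} -> Prop) :
  (exists p, S p) -> exists2 p, S p & forall s, S s -> (size p <= size s)%N.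
Proof.
case=> p; have [n] := ubnP (size p); elim: n p => // n IH p ltn Sp.
have [[s Ss lts]|H] := classic (exists2 s, S s & (size s < size p)%N).
  by apply: (IH s) => //; exact: leq_trans lts ltn.
exists p => // s Ss; rewrite leqNgt; apply/negP => lts.
by apply: H; exists s.
Qed.

Lemma exists_integral_multiple (F : realFieldType) (h : F) (p : {poly rat}) :
  p != 0 -> root (map_poly ratr p) h ->
  exists (c : int) (n : nat) (q : {poly int}),
  [/\ c != 0, q \is monic, size q = n.+2, root (map_poly intr q) (c%:~R * h) &
   forall s : {poly rat}, s != 0 -> root (map_poly ratr s) (c%:~R * h) ->
    (n.+2 <= size s)%N].
Proof.
move=> p0 rp.
have [] := @exists_min_size _ (fun s => s != 0 /\ root (map_poly ratr s) h).
  by exists p.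
move=> {rp p0}p [p0 rp] min_p.
have [q [d d0 pE]] := rat_poly_scale p.
have dQ0 : d%:~R != 0 :> rat by rewrite intr_eq0.
have sq : size q = size p.
  by rewrite pE size_scale ?invr_neq0 // size_map_poly_id0 ?intr_eq0 ?lead_coef_eq0 //;
    apply: contraNneq p0 => q0; rewrite pE q0 rmorph0 scaler0.
have rq : root (map_poly intr q) h.
  move: rp; rewrite pE map_polyZ rootZ ?fmorph_eq0 ?invr_eq0 //.
  by rewrite -map_poly_comp (eq_map_poly (fun x => ratr_int F x)).
have : (1 < size p)%N.
  apply: contraLR rp; rewrite -leqNgt => /size1_polyC pc.
  by rewrite pc map_polyC rootC fmorph_eq0 -polyC_eq0 -pc.
case sp : (size p) => [|[|n]] // _.
set c := lead_coef q.
have c0 : c != 0 by rewrite lead_coef_eq0 -size_poly_eq0 sq sp.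
have cF0 : c%:~R != 0 :> F by rewrite intr_eq0.
have lq : q`_n.+1 = c by rewrite /c lead_coefE sq sp.
pose r := \poly_(i < n.+1) (q`_i * c ^+ (n - i)).
have sr : (size r <= n.+1)%N by apply: size_poly.
(* c^n q(X/c), with c the leading coefficient of the minimal integer polynomial q *)
exists c, n, ('X^(n.+1) + r); split=> //.
- by rewrite monicE lead_coefDl ?lead_coefXn // size_polyXn.
- by rewrite size_polyDl size_polyXn // ltnS.
- apply/eqP; rewrite rmorphD /= map_polyXn hornerD hornerXn.
  have -> : map_poly intr r = \poly_(i < n.+1) ((q`_i)%:~R * c%:~R ^+ (n - i)) :> {poly F}.
    apply/polyP => i; rewrite coef_map !coef_poly.
    by case: ifP => _ /=; rewrite ?rmorph0 // rmorphM rmorphXn.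
  rewrite horner_poly; move/eqP: rq; rewrite horner_coef size_map_poly_id0; last first.
    by rewrite intr_eq0.
  rewrite sq sp big_ord_recr /= !coef_map /= lq => /(congr1 (fun z => c%:~R ^+ n * z)).
  rewrite mulr0 => qh0; rewrite -[RHS]qh0 mulrDr [RHS]addrC mulr_sumr; congr (_ + _).
    by rewrite exprMn exprSr mulrA.
  apply: eq_bigr => i _; rewrite coef_map /= exprMn.
  have -> : c%:~R ^+ n = c%:~R ^+ (n - i) * c%:~R ^+ i :> F.
    by rewrite -exprD subnK // -ltnS.
  ring.
(* Minimality transfers back to h: s(c X) has the size of s and vanishes at h. *)
move=> s s0 rs; rewrite -sp.
have cQ0 : c%:~R != 0 :> rat by rewrite intr_eq0.
have s2 : size (c%:~R *: 'X : {poly rat}) = 2%N by rewrite size_scale // size_polyX.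
rewrite -(@size_comp_poly2 _ s _ s2); apply: min_p; split.
  by rewrite -size_poly_eq0 size_comp_poly2 // size_poly_eq0.
move: rs; rewrite map_comp_poly /root horner_comp map_polyZ map_polyX hornerZ hornerX.
by rewrite /= ratr_int.
Qed.

(** After one more squaring, T > Z^(4 E1) turns the power of Z into less than T^(T^4), and T >= 4 E2
    + 2 gives T^4 + 4 E2 T^3 <= 2 (T^4 - 1). *)
Lemma exponent_growth (Z : R) E1 E2 : 1 <= Z -> exists2 T, (0 < T)%N &
  (Z ^+ (E1 * T ^ 4) * T%:R ^+ (E2 * T ^ 3)) ^+ 2 < T%:R ^+ (T ^ 4).-1.
Proof.
move=> Z1; have Z0 := le_trans ler01 Z1; pose T := maxn (4 * E2 + 2) (Num.truncn (Z ^+ (4 * E1))).+1.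
have TE : (4 * E2 + 2 <= T)%N by rewrite leq_maxl.
have T0 : (0 < T)%N by rewrite (leq_trans _ TE) // addn2.
have TZ : Z ^+ (4 * E1) < T%:R.
  apply: lt_le_trans (truncnS_gt _) _.
  by rewrite ler_nat leq_maxr.
exists T => //; have T1 : 1 <= T%:R :> R by rewrite ler1n.
have T0' : 0 < T%:R :> R by rewrite ltr0n.
rewrite -(@ltr_pXn2r _ 2) ?nnegrE ?exprn_ge0 ?mulr_ge0 ?exprn_ge0 //.
have L2 : (T ^ 4 + 4 * (E2 * T ^ 3) <= (T ^ 4).-1 * 2)%N.
  rewrite (expnS _ 3) -/(T ^ 3)%N; have : (0 < T ^ 3)%N by rewrite expn_gt0 T0.
  move: (T ^ 3)%N TE T0 => y; nia.
rewrite -[X in _ < X]exprM; apply: lt_le_trans (ler_weXn2l T1 L2).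
rewrite exprD.
have -> : (Z ^+ (E1 * T ^ 4) * T%:R ^+ (E2 * T ^ 3)) ^+ 2 ^+ 2
   = (Z ^+ (4 * E1)) ^+ (T ^ 4) * T%:R ^+ (4 * (E2 * T ^ 3)) :> R.
  by rewrite -!exprM exprMn -!exprM; congr (Z ^+ _ * _ ^+ _); ring.
rewrite ltr_pM2r ?exprn_gt0 // ltrXn2r ?exprn_ge0 //.
by rewrite -lt0n expn_gt0 T0.
Qed.

(** * The grid of points and the size of its determinant *)

Lemma fact_leq_exp n : (n`! <= n ^ n)%N.
Proof.
rewrite fact_prod -[X in (_ <= n ^ X)%N](subn1 n.+1) -prod_nat_const_nat.
by rewrite big_nat [leqRHS]big_nat leq_prod // => i /andP[_].
Qed.

(** The second reduction modulo I bounds the points for every natural l, because the interpolation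
    bound takes an infinite sequence of nodes. *)
Definition grid_point (h : R) I l : R :=
  ((l %% I)%:R + ((l %/ I) %% I)%:R * h)%R.

Lemma grid_point_bounds h I l : 0 < h -> (0 < I)%N ->
  0 <= grid_point h I l <= I%:R * (1 + h).
Proof.
move=> /ltW h0 I0; rewrite addr_ge0 ?mulr_ge0 //= mulrDr mulr1 lerD //.
  by rewrite ler_nat ltnW // ltn_mod.
by rewrite ler_wpM2r // ler_nat ltnW // ltn_mod.
Qed.

Lemma grid_point_inj h I i j :
  (forall a b a' b' : nat, a%:R + b%:R * h = a'%:R + b'%:R * h -> b = b') ->
  (i < I * I)%N -> (j < I * I)%N -> grid_point h I i = grid_point h I j -> i = j.
Proof.
move=> irr li lj; rewrite /grid_point !(@modn_small (_ %/ I)%N) ?ltn_divLR //; last first.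
- by case: I li {lj} => //; rewrite mul0n.
- by case: I li {lj} => //; rewrite mul0n.
move=> H; have q := irr _ _ _ _ H; move: H; rewrite q => /addIr/eqP.
by rewrite eqr_nat => /eqP r; rewrite (divn_eq i I) (divn_eq j I) q r.
Qed.

Lemma exp_ge0 (x : R) : 0 <= exp x.
Proof. exact/RleP/Rlt_le/exp_pos. Qed.

Lemma le_exp (x y : R) : (x <= y)%R -> (exp x <= exp y)%R.
Proof.
rewrite le_eqVlt => /orP[/eqP-> //|/RltP xy].
exact/RleP/Rlt_le/exp_increasing.
Qed.

Definition grid_matrix (c h : R) T : 'M[R]_(T ^ 3 * T) :=
  \matrix_(l, m) (grid_point h (T ^ 2) l ^+ (m %% T ^ 3)
                  * exp (c * grid_point h (T ^ 2) l)%R ^+ (m %/ T ^ 3)).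

(** The powers of 1/T are moved to the left as powers of T. On the right T^4 comes from L! <= L^L,
    (T^3 Z)^(T^3) from rho^(T^3), and Z^(T^4) from exp (|c| * rho)^T. *)
Lemma grid_det_le c h : 0 < h -> exists2 Z : R, 1 <= Z & forall T, (0 < T)%N ->
  `|\det (grid_matrix c h T)| * \prod_(n < T ^ 3 * T) T%:R ^+ n
   <= (T%:R ^+ 4 * (T%:R ^+ 3 * Z) ^+ (T ^ 3) * Z ^+ (T ^ 4)) ^+ (T ^ 3 * T).
Proof.
move=> h0; have h0' := ltW h0; pose H := 2 * (1 + h); pose W := exp (`|c| * H)%R.
have H1 : 1 <= H by rewrite /H; lra.
have H0 : 0 <= H by rewrite (le_trans ler01).
have cH0 : 0 <= `|c| * H by rewrite mulr_ge0.
have W0 : 0 <= W by exact: exp_ge0.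
exists (H + W); first by rewrite ler_wpDr.
move=> T T0; have T1 : 1 <= T%:R :> R by rewrite ler1n.
have Tp : 0 < T%:R :> R by rewrite ltr0n.
have Tp' := ltW Tp.
(* rho is chosen so that X / (rho - X) = 1 / T *)
pose X := (T ^ 2)%:R * (1 + h); pose rho := X * (1 + T%:R).
have X0 : 0 < X by rewrite mulr_gt0 ?ltr0n ?expn_gt0 ?T0 // addr_gt0.
have X1 : 1 <= X.
  by rewrite -[1]mulr1 ler_pM ?ler1n ?expn_gt0 ?T0 // lerDl ltW.
have rX : rho - X = X * T%:R by rewrite /rho; ring.
have Xr : X < rho by rewrite -subr_gt0 rX mulr_gt0.
have r1 : 1 <= rho by rewrite (le_trans X1) // ltW.
have r0 : 0 <= rho by rewrite (le_trans ler01).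
have rH : rho <= T%:R ^+ 3 * H.
  rewrite /rho /X natrX (_ : T%:R ^+ 3 * H = T%:R ^+ 2 * (1 + h) * (T%:R * 2)); last first.
    by rewrite /H; ring.
  rewrite ler_wpM2l ?mulr_ge0 ?exprn_ge0 ?addr_ge0 //.
  by rewrite mulr_natr mulr2n lerD2r.
have T30 : (0 < T ^ 3)%N by rewrite expn_gt0 T0.
have := @exp_interpolation_det_le c (grid_point h (T ^ 2)) (T ^ 3) T X rho T30.
have hb i : 0 <= grid_point h (T ^ 2) i <= X.
  by apply: grid_point_bounds; rewrite // expn_gt0 T0.
move=> /(_ hb Xr r1); rewrite -/(grid_matrix c h T).
have -> : X / (rho - X) = T%:R^-1 by rewrite rX; field; rewrite !gt_eqF.
pose F := rho ^+ (T ^ 3) * exp (`|c| * rho)%R ^+ T; rewrite -/F; set L := (T ^ 3 * T)%N; rewrite big_split /= => le1.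
have F0 : 0 <= F.
  by rewrite mulr_ge0 ?exprn_ge0 ?exp_ge0.
have TT0 : 0 < \prod_(n < L) T%:R ^+ n :> R.
  by apply: prodr_gt0 => n _; rewrite exprn_gt0.
have prod1 : (\prod_(n < L) T%:R^-1 ^+ n) * \prod_(n < L) T%:R ^+ n = 1 :> R.
  rewrite -big_split big1 //= => n _.
  by rewrite exprVn mulVf // expf_neq0 // gt_eqF.
have le2 := ler_wpM2r (ltW TT0) le1.
rewrite -!mulrA prod1 mulr1 prodr_const card_ord in le2; apply: (le_trans le2).
have LL : (L`!)%:R <= (T%:R ^+ 4) ^+ L :> R.
  rewrite -!natrX ler_nat (_ : T ^ 4 = L)%N; last by rewrite /L -expnSr.
  exact: fact_leq_exp.
apply: (@le_trans _ _ ((T%:R ^+ 4) ^+ L * F ^+ L)); first by rewrite ler_wpM2r ?exprn_ge0.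
have HW0 : 0 <= H + W by rewrite addr_ge0.
have B0 : 0 <= T%:R ^+ 3 * (H + W) by rewrite mulr_ge0 ?exprn_ge0.
have T40 : 0 <= T%:R ^+ 4 :> R by apply: exprn_ge0.
rewrite -exprMn; apply: lerXn2r; rewrite ?nnegrE.
- exact: mulr_ge0.
- by apply: mulr_ge0; [apply: mulr_ge0 => //|]; apply: exprn_ge0.
rewrite -mulrA ler_wpM2l ?exprn_ge0 // ler_pM ?exprn_ge0 ?exp_ge0 //.
- apply: lerXn2r; rewrite ?nnegrE //.
  by rewrite (le_trans rH) // ler_wpM2l ?exprn_ge0 // lerDl.
have -> : (T ^ 4 = T ^ 3 * T)%N by rewrite -expnSr.
rewrite exprM lerXn2r ?nnegrE ?exprn_ge0 ?addr_ge0 ?exp_ge0 //.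
apply: (@le_trans _ _ (W ^+ (T ^ 3))); last first.
  by rewrite lerXn2r ?nnegrE ?addr_ge0 // lerDr.
rewrite -exp_natM; apply: le_exp.
rewrite natrX (_ : T%:R ^+ 3 * (`|c| * H) = `|c| * (T%:R ^+ 3 * H)); last by ring.
by rewrite ler_wpM2l.
Qed.

(** Each of the two matrix powers and the scalar matrix loses a factor [n.+1]; together they make up
    M^3. *)
Lemma mxnorm_entry (n : nat) (G : 'M[int]_n.+1) (c s M S : int) (i j p t I P t' : nat) :
  (n.+1%:Z * (`|c| + mxnorm G + 1) <= M) ->
  (i <= I)%N -> (j <= I)%N -> (p <= P)%N -> (t <= t')%N -> (0 < I)%N -> `|s| <= S ->
  mxnorm (horner_mx G (((c *+ i)%:P + 'X *+ j) ^+ p * 'X^t * s%:P))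
    <= M ^+ 3 * (I%:Z * M) ^+ P * M ^+ t' * S.
Proof.
move=> hM li lj lp lt I0 hs.
have g0 := mxnorm_ge0 G; have c0 : 0 <= `|c| := normr_ge0 c.
have N1 : 1 <= n.+1%:Z :> int by rewrite lez_nat.
have NM : n.+1%:Z <= M.
  by apply: le_trans hM; rewrite ler_peMr // lerDr addr_ge0.
have gM : mxnorm G <= M.
  apply: le_trans hM; apply: (@le_trans _ _ (1 * (`|c| + mxnorm G + 1))).
    by rewrite mul1r -addrA addrCA lerDl addr_ge0.
  by rewrite ler_wpM2r ?addr_ge0.
have M1 : 1 <= M := le_trans N1 NM.
have M0 : 0 <= M := le_trans ler01 M1.
have IM1 : 1 <= I%:Z * M by rewrite mulr_ege1.
have IM0 := le_trans ler01 IM1.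
have S0 : 0 <= S by apply: le_trans hs.
rewrite !rmorphM !rmorphXn /= rmorphD /= [X in _ + X]rmorphMn /=.
rewrite horner_mx_X !horner_mx_C.
have leA : mxnorm ((c *+ i)%:M + G *+ j) <= I%:Z * M.
  apply: (le_trans (mxnormD _ _)); rewrite mxnorm_scalar normrMn.
  have -> : mxnorm (G *+ j) = mxnorm G *+ j.
    rewrite -sumrMnl; apply: eq_bigr => a _; rewrite -sumrMnl.
    by apply: eq_bigr => b _; rewrite mulmxnE normrMn.
  rewrite -(mulr_natl (_ *+ i)) -(mulr_natl `|c|) -(mulr_natl (mxnorm G)) !natz.
  apply: (@le_trans _ _ (I%:Z * (n.+1%:Z * (`|c| + mxnorm G + 1)))); last first.
    by rewrite ler_wpM2l.
  have -> : I%:Z * (n.+1%:Z * (`|c| + mxnorm G + 1)) =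
    n.+1%:Z * (I%:Z * `|c|) + I%:Z * (n.+1%:Z * mxnorm G) + I%:Z * n.+1%:Z by ring.
  rewrite ler_wpDr // lerD //; first by rewrite !ler_wpM2l // ler_wpM2r.
  by rewrite ler_pM // ler_peMl.
apply: (le_trans (mxnormM _ _)).
have h1 : mxnorm (((c *+ i)%:M + G *+ j) ^+ p) <= M * (I%:Z * M) ^+ P.
  apply: (le_trans (mxnormX _ _)); rewrite natz; apply: ler_pM => //; rewrite ?exprn_ge0 ?mxnorm_ge0 //.
  apply: (@le_trans _ _ ((I%:Z * M) ^+ p)); last by rewrite (ler_weXn2l IM1).
  by apply: lerXn2r => //; rewrite nnegrE // mxnorm_ge0.
have h2 : mxnorm (G ^+ t) <= M * M ^+ t'.
  apply: (le_trans (mxnormX _ _)); rewrite natz; apply: ler_pM => //; rewrite ?exprn_ge0 //.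
  apply: (@le_trans _ _ (M ^+ t)); last by rewrite (ler_weXn2l M1).
  by apply: lerXn2r => //; rewrite nnegrE.
have h3 : mxnorm (s%:M : 'M_n.+1) <= M * S.
  by rewrite mxnorm_scalar -mulr_natl natz; apply: ler_pM.
have -> : M ^+ 3 * (I%:Z * M) ^+ P * M ^+ t' * S =
  (M * (I%:Z * M) ^+ P) * (M * M ^+ t') * (M * S) by ring.
apply: ler_pM => //; rewrite ?mxnorm_ge0 //.
by apply: (le_trans (mxnormM _ _)); apply: ler_pM => //; rewrite ?mxnorm_ge0.
Qed.

(** * Integrality of the scaled determinant *)

Section LowerBound.
Variables (h c0 : R) (a b k : nat) (c : int).
Hypotheses (b0 : (0 < b)%N) (exp_c0 : exp c0 = a%:R / b%:R)
  (exp_c0h : exp (c0 * h)%R = h ^+ k).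

(** The exponents are bounds: p <= T^3 for (i + j h)^p, k r j <= k T^3 for h^(k r j), and r i <= T^3
    for the denominator of (a/b)^(r i). *)
Let D T : R := (c%:~R ^+ (T ^ 3 + k * T ^ 3) * b%:R ^+ (T ^ 3))%R.

(* The entries of [grid_matrix], scaled by [D T] so as to become integer polynomials in
   [c * h]. *)
Definition grid_poly T : 'M[{poly int}]_(T ^ 3 * T) := \matrix_(l, m)
  let p := (m %% T ^ 3)%N in let r := (m %/ T ^ 3)%N in
  let i := (l %% T ^ 2)%N in let j := ((l %/ T ^ 2) %% T ^ 2)%N in
  ((c *+ i)%:P + 'X *+ j) ^+ p * 'X^(k * (r * j)) *
  (c ^+ (T ^ 3 - p) * a%:Z ^+ (r * i) * b%:Z ^+ (T ^ 3 - r * i)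
     * c ^+ (k * (T ^ 3 - r * j)))%:P.

Lemma grid_index_le T (l m : 'I_(T ^ 3 * T)) (r := (m %/ T ^ 3)%N) : (0 < T)%N ->
  (r * (l %% T ^ 2) <= T ^ 3)%N /\ (r * ((l %/ T ^ 2) %% T ^ 2) <= T ^ 3)%N.
Proof.
move=> T0; have rT : (r <= T)%N.
  by rewrite ltnW // ltn_divLR ?expn_gt0 ?T0 // [(T * _)%N]mulnC.
have H x : (r * (x %% T ^ 2) <= T ^ 3)%N.
  by rewrite (expnS T 2) leq_mul // ltnW // ltn_mod expn_gt0 T0.
by split.
Qed.

Lemma horner_det_grid_poly T : (0 < T)%N ->
  (map_poly intr (\det (grid_poly T))).[c%:~R * h]
   = D T ^+ (T ^ 3 * T) * \det (grid_matrix c0 h T).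
Proof.
move=> T0; rewrite -detZ -det_map_mx -horner_evalE -det_map_mx.
congr (\det _); apply/matrixP => l m; rewrite !mxE /=.
have [le1 le2] := grid_index_le l m T0; move: le1 le2.
have lep : (m %% T ^ 3 <= T ^ 3)%N by rewrite ltnW // ltn_mod expn_gt0 T0.
rewrite /grid_point; move: (m %/ T ^ 3)%N (m %% T ^ 3)%N lep => r p lep.
move: (l %% T ^ 2)%N ((l %/ T ^ 2) %% T ^ 2)%N => {l m} i j.
rewrite /D; move: (T ^ 3)%N lep => P lep le1 le2.
rewrite horner_evalE !rmorphM !rmorphXn rmorphD rmorphMn /= map_polyC map_polyX map_polyC /=.
rewrite !hornerE /= !rmorphMn /= !map_polyC map_polyX !hornerMn !hornerE /=.
have bR0 : b%:R != 0 :> R by rewrite pnatr_eq0 -lt0n.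
have -> : exp (c0 * (i%:R + j%:R * h))%R = (a%:R / b%:R) ^+ i * h ^+ (k * j).
  rewrite (_ : c0 * (i%:R + j%:R * h) = i%:R * c0 + j%:R * (c0 * h)); last by ring.
  by rewrite -expRD !exp_natM exp_c0 exp_c0h exprM.
rewrite -[X in c%:~R ^+ (X + _)](subnK lep) -[X in c%:~R ^+ (_ + k * X)](subnK le2).
rewrite -[X in b%:R ^+ X](subnK le1) mulnDr !exprD !exprMn exprVn -!exprM.
rewrite -(mulr_natl c%:~R) -(mulr_natl (_ * h)).
have -> : i%:R * c%:~R + j%:R * (c%:~R * h) = c%:~R * (i%:R + j%:R * h) :> R by ring.
rewrite exprMn [(k * (r * j))%N]mulnCA [(i * r)%N]mulnC (mulnC _ r).
have : b%:R ^+ (r * i) != 0 :> R by rewrite expf_neq0.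
move=> H; rewrite -!pmulrn exprVn -exprM [(i * r)%N]mulnC.
have -> : (r * (k * j) = r * k * j)%N by rewrite mulnA.
have -> : (k * j * r = r * k * j)%N by ring.
move: (r * k * j)%N (P - r * i)%N (P - p)%N (k * (P - r * j))%N (r * i)%N H => e1 e2 e3 e4 e5 H.
by field.
Qed.

End LowerBound.

(** T^4 comes from L! and T^(2 T^3) from the grid side T^2. In the exponent of M, 4 is the M^3 of
    [mxnorm_entry] plus one for [n.+1], and (4 + 2 k) T^3 collects the linear form, the power of X
    and the four scalar factors. *)
Lemma mxnorm_grid_poly (a b k : nat) (c : int) (n : nat) (G : 'M[int]_n.+1) (M : int) T :
  n.+1%:Z * (`|c| + mxnorm G + 1) + a%:Z + b%:Z <= M -> (0 < T)%N ->
  mxnorm (horner_mx G (\det (grid_poly a b k c T))) <=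
    (T%:Z ^+ (4 + 2 * T ^ 3) * M ^+ (4 + (4 + 2 * k) * T ^ 3)) ^+ (T ^ 3 * T).
Proof.
move=> hM T0; have g0 := mxnorm_ge0 G; have cn0 : 0 <= `|c| := normr_ge0 c.
have N1 : 1 <= n.+1%:Z :> int by rewrite lez_nat.
have y1 : 1 <= `|c| + mxnorm G + 1 by rewrite lerDr addr_ge0.
have Y0 : 0 <= n.+1%:Z * (`|c| + mxnorm G + 1) by rewrite mulr_ge0 ?addr_ge0.
have [hM' aM bM] : [/\ n.+1%:Z * (`|c| + mxnorm G + 1) <= M, a%:Z <= M & b%:Z <= M].
  by move: Y0 hM; move: (n.+1%:Z * _) => Y Y0 hM; split; lia.
have NM : n.+1%:Z <= M by apply: le_trans hM'; rewrite ler_peMr.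
have cM : `|c| <= M.
  apply: le_trans hM'; apply: (@le_trans _ _ (1 * (`|c| + mxnorm G + 1))).
    by rewrite mul1r -addrA lerDl addr_ge0.
  by rewrite ler_wpM2r ?addr_ge0.
have M1 : 1 <= M := le_trans N1 NM.
have M0 : 0 <= M := le_trans ler01 M1.
have T30 : (0 < T ^ 3)%N by rewrite expn_gt0 T0.
have T20 : (0 < T ^ 2)%N by rewrite expn_gt0 T0.
pose S := M ^+ (T ^ 3) * M ^+ (T ^ 3) * M ^+ (T ^ 3) * M ^+ (k * T ^ 3).
pose e := M ^+ 3 * ((T ^ 2)%N%:Z * M) ^+ (T ^ 3) * M ^+ (k * T ^ 3) * S.
have powM x s t : 0 <= x <= M -> (s <= t)%N -> 0 <= x ^+ s <= M ^+ t.
  case/andP=> x0 xM st; rewrite exprn_ge0 //=.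
  apply: le_trans (ler_weXn2l M1 st).
  by apply: lerXn2r; rewrite ?nnegrE.
have le_mul (x1 x2 z1 z2 : int) : 0 <= x1 <= z1 -> 0 <= x2 <= z2 -> 0 <= x1 * x2 <= z1 * z2.
  by move=> /andP[? ?] /andP[? ?]; rewrite mulr_ge0 // ler_pM.
have le_e (l m : 'I_(T ^ 3 * T)) : mxnorm (horner_mx G (grid_poly a b k c T l m)) <= e.
  have [le1 le2] := grid_index_le l m T0.
  rewrite /grid_poly mxE; apply: (mxnorm_entry hM' _ _ _ _ T20).
  - by rewrite ltnW // ltn_mod.
  - by rewrite ltnW // ltn_mod.
  - by rewrite ltnW // ltn_mod.
  - by rewrite leq_mul2l le2 orbT.
  have c2 : 0 <= `|c| <= M by rewrite normr_ge0.
  rewrite !normrM !normrX !(ger0_norm (le0z_nat _)).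
  have a2 : 0 <= a%:Z <= M by rewrite aM.
  have b2 : 0 <= b%:Z <= M by rewrite bM.
  have h1 := powM `|c| _ _ c2 (leq_subr (m %% T ^ 3) (T ^ 3)).
  have h2 := powM a%:Z _ _ a2 le1.
  have h3 := powM b%:Z _ _ b2 (leq_subr ((m %/ T ^ 3) * (l %% T ^ 2)) (T ^ 3)).
  have h4 : 0 <= `|c| ^+ (k * (T ^ 3 - (m %/ T ^ 3) * ((l %/ T ^ 2) %% T ^ 2)))
              <= M ^+ (k * T ^ 3) by apply: powM; rewrite ?leq_mul2l ?leq_subr ?orbT.
  by have /andP[_] := le_mul _ _ _ _ (le_mul _ _ _ _ (le_mul _ _ _ _ h1 h2) h3) h4.
apply: (le_trans (mxnorm_horner_det le_e)).
set L := (T ^ 3 * T)%N; have L0 : (0 < L)%N by rewrite muln_gt0 T30.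
have LL : (L`!)%:R <= (T%:Z ^+ 4) ^+ L :> int.
  rewrite -(natz T) -!natrX ler_nat (_ : T ^ 4 = L)%N; last by rewrite /L -expnSr.
  exact: fact_leq_exp.
have NL : n.+1%:R <= M ^+ L :> int.
  by rewrite natz (le_trans NM) // ler_eXnr.
have -> : T%:Z ^+ (4 + 2 * T ^ 3) * M ^+ (4 + (4 + 2 * k) * T ^ 3) = M * T%:Z ^+ 4 * e.
  rewrite /e /S (_ : (T ^ 2)%N%:Z = T%:Z ^+ 2); last by rewrite -natz natrX natz.
  move: (T ^ 3)%N => P.
  have -> : ((4 + 2 * k) * P = P + P + P + P + k * P + k * P)%N by ring.
  have -> : (T%:Z ^+ 2 * M) ^+ P = T%:Z ^+ (2 * P) * M ^+ P by rewrite exprMn -exprM.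
  by rewrite !exprD; ring.
have e0 : 0 <= e.
  by rewrite /e /S; repeat (apply: mulr_ge0 || apply: exprn_ge0).
rewrite [(_ * e) ^+ L]exprMn [(M * _) ^+ L]exprMn; apply: ler_wpM2r; first exact: exprn_ge0.
exact: ler_pM.
Qed.

(** Squaring clears the half in 0 + ... + (n - 1) = n (n - 1) / 2. *)
Lemma prod_exp_sqr (x : R) n : (\prod_(i < n) x ^+ i) ^+ 2 = (x ^+ n.-1) ^+ n.
Proof.
elim: n => [|n IH]; first by rewrite big_ord0 expr1n.
rewrite big_ord_recr /= exprMn IH; case: n {IH} => [|n] /=.
  by rewrite !(expr0, expr1n, mulr1).
by rewrite -!exprM -exprD; congr (x ^+ _); ring.
Qed.

Lemma ler_expr (F : numDomainType) (x y : F) n :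
  0 <= x -> x <= y -> x ^+ n <= y ^+ n.
Proof. by move=> x0 xy; apply: lerXn2r; rewrite ?nnegrE // (le_trans x0). Qed.

Lemma mulX_ge0 (F : numDomainType) (x y : F) s t :
  0 <= x -> 0 <= y -> 0 <= x ^+ s * y ^+ t.
Proof. by move=> x0 y0; rewrite mulr_ge0 ?exprn_ge0. Qed.

(** * The contradiction for irrational h *)

Section GelfondSchneider.
Variables (h c0 : R) (a b k : nat) (p : {poly rat}).
Hypotheses (h0 : 0 < h) (c0_neq0 : c0 != 0) (b0 : (0 < b)%N)
  (exp_c0 : exp c0 = a%:R / b%:R) (exp_c0h : exp (c0 * h)%R = h ^+ k)
  (p0 : p != 0) (rp : root (map_poly ratr p) h)
  (irr : forall i j i' j' : nat, i%:R + j%:R * h = i'%:R + j'%:R * h -> j = j').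

Lemma grid_det_neq0 T : (0 < T)%N -> \det (grid_matrix c0 h T) != 0.
Proof.
move=> T0; apply: (interpolation_det_neq0 c0_neq0); first by rewrite expn_gt0 T0.
have -> : (T ^ 3 * T = T ^ 2 * T ^ 2)%N by ring.
by move=> i j li lj; apply: grid_point_inj.
Qed.

Lemma grid_det_ge : exists (Z : R) w, 1 <= Z /\ forall T, (0 < T)%N ->
  1 <= (Z ^+ (w * T ^ 3) * T%:R ^+ (w * T ^ 3)) ^+ (T ^ 3 * T)
       * `|\det (grid_matrix c0 h T)|.
Proof.
have [c [n [q [c_neq0 q_monic size_q q_root q_min]]]] := exists_integral_multiple p0 rp.
have [G char_G] := exists_companion q_monic size_q.
have [K K0 liou] := liouville q_monic size_q q_root q_min char_G.
pose M : int := n.+1%:Z * (`|c| + mxnorm G + 1) + a%:Z + b%:Z.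
have cn0 : 0 <= `|c| := normr_ge0 c.
have y0 : 0 <= n.+1%:Z * (`|c| + mxnorm G + 1) by rewrite mulr_ge0 ?addr_ge0 ?mxnorm_ge0.
have M0 : 0 <= M%:~R :> R by rewrite ler0z /M !addr_ge0.
have cM : `|c%:~R| <= M%:~R :> R.
  rewrite -intr_norm ler_int; apply: (@le_trans _ _ (n.+1%:Z * (`|c| + mxnorm G + 1))).
    apply: (@le_trans _ _ (1 * (`|c| + mxnorm G + 1))).
      by rewrite mul1r -addrA lerDl addr_ge0 ?mxnorm_ge0.
    by rewrite ler_wpM2r ?addr_ge0 ?mxnorm_ge0 // lez_nat.
  by rewrite /M -[leRHS]addrA lerDl addr_ge0.
have bM : b%:R <= M%:~R :> R.
  by rewrite pmulrn ler_int /M lerDr addr_ge0.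
pose Z : R := (K + M%:~R + 1)%R.
have Z1 : 1 <= Z by rewrite /Z lerDr addr_ge0 // ltW.
have Z0 : 0 <= Z := le_trans ler01 Z1.
have KZ : K <= Z by rewrite /Z -addrA lerDl addr_ge0.
have MZ : M%:~R <= Z by rewrite /Z addrAC lerDr addr_ge0 // ltW.
(* For P = T^3 >= 1: 2 + k from D, one from K, and n times 4 + (4 + 2 k) from the n-th power of the
   matrix norm. *)
pose w := (3 + k + n * (8 + 2 * k))%N.
have arith1 P : (0 < P)%N -> (((2 + k) * P).+1 + (4 + (4 + 2 * k) * P) * n <= w * P)%N.
  by clear; move=> P0; rewrite /w; have := leq_pmulr n P0; lia.
have arith2 P : (0 < P)%N -> ((4 + 2 * P) * n <= w * P)%N.
  by clear; move=> P0; rewrite /w; have := leq_pmulr n P0; lia.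
exists Z, w; split=> // T T0; set L := (T ^ 3 * T)%N.
have T30 : (0 < T ^ 3)%N by rewrite expn_gt0 T0.
have L0 : (0 < L)%N by rewrite muln_gt0 T30.
have T1 : 1 <= T%:R :> R by rewrite ler1n.
have Tp : 0 <= T%:R :> R by [].
have ev := horner_det_grid_poly c b0 exp_c0 exp_c0h T0.
set D := _ ^+ _ * _ ^+ _ in ev.
have D_neq0 : D != 0.
  by rewrite mulf_neq0 // expf_neq0 // ?intr_eq0 // pnatr_eq0 -lt0n.
have Ug : (map_poly intr (\det (grid_poly a b k c T))).[c%:~R * h] != 0 :> R.
  by rewrite ev mulf_neq0 ?expf_neq0 // grid_det_neq0.
move: (liou _ Ug) => /le_trans; apply; rewrite ev normrM normrX.
have leD : `|D| <= Z ^+ ((2 + k) * T ^ 3).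
  rewrite normrM !normrX normr_nat.
  have -> : ((2 + k) * T ^ 3 = (T ^ 3 + k * T ^ 3) + T ^ 3)%N by ring.
  rewrite [Z ^+ _]exprD; apply: ler_pM; rewrite ?exprn_ge0 //.
    by apply: ler_expr => //; rewrite (le_trans cM).
  by apply: ler_expr => //; rewrite (le_trans bM).
(* All factors go under the exponent L; there the constant K costs a single Z. *)
have KL : K <= Z ^+ L by rewrite (le_trans KZ) // ler_eXnr.
have := @mxnorm_grid_poly a b k c n G M T (lexx _) T0.
rewrite -(ler_int R) rmorphXn rmorphM !rmorphXn /= -pmulrn => leN.
set N := (mxnorm _)%:~R in leN *.
have N0 : 0 <= N by rewrite ler0z mxnorm_ge0.
pose e := T%:R ^+ (4 + 2 * T ^ 3) * Z ^+ (4 + (4 + 2 * k) * T ^ 3).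
have e0 : 0 <= e by apply: mulX_ge0.
have {}leN : N <= e ^+ L.
  apply: (le_trans leN); apply: ler_expr; first exact: mulX_ge0.
  by apply: ler_wpM2l; [exact: exprn_ge0 | exact: ler_expr].
rewrite [K * _]mulrA mulrAC; apply: ler_wpM2r; first exact: normr_ge0.
have D0 : 0 <= `|D| ^+ L by rewrite exprn_ge0.
have K0' := ltW K0.
apply: (@le_trans _ _ (Z ^+ L * (Z ^+ ((2 + k) * T ^ 3)) ^+ L * (e ^+ n) ^+ L)).
  apply: ler_pM; first exact: mulr_ge0; first exact: exprn_ge0.
    by apply: ler_pM => //; exact: ler_expr.
  by rewrite exprAC; exact: ler_expr.
rewrite -(exprMn L) -(exprMn L); apply: ler_expr.
  by apply: mulr_ge0; [apply: mulr_ge0 => //|]; apply: exprn_ge0; rewrite ?exprn_ge0.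
have -> : e ^+ n = T%:R ^+ ((4 + 2 * T ^ 3) * n) * Z ^+ ((4 + (4 + 2 * k) * T ^ 3) * n).
  by rewrite /e (exprMn n) -!exprM.
rewrite [_ * (T%:R ^+ _ * _)]mulrCA [leLHS]mulrC -exprS -exprD.
apply: ler_pM; rewrite ?exprn_ge0 //; apply: ler_weXn2l => //.
  exact: arith1.
exact: arith2.
Qed.

Lemma gelfond_schneider_contradiction : False.
Proof.
have [Z1 Z1_ge1 up] := grid_det_le c0 h0.
have [Z2 [w [Z2_ge1 low]]] := grid_det_ge.
have Z1_ge0 := le_trans ler01 Z1_ge1; have Z2_ge0 := le_trans ler01 Z2_ge1.
pose Z := Z1 + Z2; have ZZ1 : Z1 <= Z by rewrite lerDl.
have ZZ2 : Z2 <= Z by rewrite lerDr.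
have Z_ge1 : 1 <= Z := le_trans Z1_ge1 ZZ1.
have Z_ge0 : 0 <= Z := le_trans Z1_ge0 ZZ1.
(* w + 2 collects Z1^(T^3), Z1^(T^4) and Z2^(w T^3); w + 7 collects T^4, T^(3 T^3) and T^(w T^3). *)
have [T T0] := exponent_growth (w + 2) (w + 7) Z_ge1.
apply/negP; rewrite -leNgt.
have arith1 P : (P + P * T + w * P <= (w + 2) * (P * T))%N.
  by have := leq_pmulr P T0; have := leq_pmulr (w * P) T0; clear; lia.
have arith2 P : (0 < P)%N -> (4 + 3 * P + w * P <= (w + 7) * P)%N.
  by clear; lia.
have T1 : 1 <= T%:R :> R by rewrite ler1n.
have Tp : 0 <= T%:R :> R by [].
have T30 : (0 < T ^ 3)%N by rewrite expn_gt0 T0.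
have LE : (T ^ 4 = T ^ 3 * T)%N by rewrite -expnSr.
have L0 : (0 < T ^ 3 * T)%N by rewrite muln_gt0 T30.
move: (up T T0) (low T T0); set L := (T ^ 3 * T)%N; set d := `|\det _|.
have d0 : 0 <= d := normr_ge0 _.
set A := _ * Z1 ^+ _; set B := Z2 ^+ _ * _ => leA leB.
pose Y := Z ^+ ((w + 2) * T ^ 4) * T%:R ^+ ((w + 7) * T ^ 3); rewrite -/Y.
have B0 : 0 <= B by apply: mulX_ge0.
have T3Z0 : 0 <= T%:R ^+ 3 * Z1 := mulr_ge0 (exprn_ge0 3 Tp) Z1_ge0.
have A0 : 0 <= A by apply: mulr_ge0; [apply: mulr_ge0; apply: exprn_ge0 | apply: exprn_ge0].
have TT0 : 0 <= \prod_(i < L) T%:R ^+ i :> R by apply: prodr_ge0 => i _; apply: exprn_ge0.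
have leAB : \prod_(i < L) T%:R ^+ i <= (A * B) ^+ L.
  rewrite (exprMn L) mulrC; apply: (@le_trans _ _ (B ^+ L * (d * \prod_(i < L) T%:R ^+ i))).
    by rewrite mulrA ler_peMl.
  by rewrite ler_wpM2l ?exprn_ge0.
have leY : A * B <= Y.
  have T40 : 0 <= T%:R ^+ 4 :> R by apply: exprn_ge0.
  have -> : A * B = (T%:R ^+ 4 * T%:R ^+ (3 * T ^ 3) * T%:R ^+ (w * T ^ 3)) *
     (Z1 ^+ (T ^ 3) * Z1 ^+ (T ^ 4) * Z2 ^+ (w * T ^ 3)).
    by rewrite /A /B (exprMn (T ^ 3)) -exprM; ring.
  rewrite /Y mulrC; apply: ler_pM; rewrite ?mulr_ge0 ?exprn_ge0 //.
    apply: (@le_trans _ _ (Z ^+ (T ^ 3) * Z ^+ (T ^ 4) * Z ^+ (w * T ^ 3))).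
      apply: ler_pM; rewrite ?mulr_ge0 ?exprn_ge0 //; last by apply: ler_expr.
      by apply: ler_pM; rewrite ?exprn_ge0 //; apply: ler_expr.
    rewrite -!exprD; apply: ler_weXn2l => //.
    by rewrite LE arith1.
  rewrite -!exprD; apply: ler_weXn2l => //.
  exact: arith2.
have Y0 : 0 <= Y by apply: le_trans leY; apply: mulr_ge0.
(* Raised to the power L, the goal is the square of the product bound, by [prod_exp_sqr]. *)
rewrite LE -/L -(@ler_pXn2r _ L) ?nnegrE ?exprn_ge0 // -prod_exp_sqr exprAC.
apply: ler_expr => //; apply: (le_trans leAB).
by apply: ler_expr => //; apply: mulr_ge0.
Qed.

End GelfondSchneider.

(** * Transfer to the definitions of the statement *)

Definition rat_of_Z (z : Z) : rat :=
  match z with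
  | Z0 => 0
  | Zpos p => (Pos.to_nat p)%:R
  | Zneg p => - (Pos.to_nat p)%:R
  end.

Lemma IZR_nat_pos p : IZR (Zpos p) = (Pos.to_nat p)%:R :> R.
Proof. by rewrite -INRE INR_IZR_INZ positive_nat_Z. Qed.

Lemma ratr_of_Z z : ratr (rat_of_Z z) = IZR z :> R.
Proof.
case: z => [|p|p]; first by rewrite rmorph0.
  by rewrite ratr_nat IZR_nat_pos.
by rewrite rmorphN /= ratr_nat -IZR_nat_pos.
Qed.

Lemma algebraic_root x : is_algebraic x ->
  exists2 p : {poly rat}, p != 0 & root (map_poly ratr p) x.
Proof.
case=> l [[z [zl z0]] lx]; pose s := [seq rat_of_Z c | c <- l].
exists (Poly s).
  have : has (fun c => c != 0) s.
    elim: l zl {lx} @s => //= c l IH [->|/IH->]; last by rewrite orbT.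
    have : ratr (rat_of_Z z) != 0 :> R.
      by rewrite ratr_of_Z; apply/eqP => /eq_IZR.
    by rewrite fmorph_eq0 => ->.
  apply: contraTneq => /polyP s0; rewrite -all_predC; apply/(all_nthP 0) => i _ /=.
  by rewrite negbK; have := s0 i; rewrite coef0 coef_Poly => ->.
apply/rootP; rewrite -{}[RHS]lx.
elim: l @s {zl} => [|c l IH] /=; first by rewrite rmorph0 horner0.
rewrite cons_poly_def rmorphD rmorphM /= map_polyX map_polyC hornerMXaddC IH.
by rewrite /= ratr_of_Z addrC mulrC.
Qed.

Lemma is_rational_pos x : is_rational x -> 0 < x ->
  exists p q : nat, [/\ (0 < p)%N, (0 < q)%N, coprime p q & x = p%:R / q%:R].
Proof.
case=> P [Q [Q0 xPQ]] x0.
have natE Z0 : exists n : nat, `|IZR Z0| = n%:R :> R.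
  case: Z0 => [|p|p]; first by exists 0%N; rewrite normr0.
    by exists (Pos.to_nat p); rewrite IZR_nat_pos normr_nat.
  exists (Pos.to_nat p); rewrite -[IZR (Zneg p)]/(- IZR (Zpos p)) normrN.
  by rewrite IZR_nat_pos normr_nat.
have [p pE] := natE P; have [q qE] := natE Q.
have xE : x = p%:R / q%:R.
  by rewrite -(gtr0_norm x0) xPQ RdivE normrM normfV pE qE.
have q0 : (0 < q)%N.
  rewrite lt0n; apply/eqP => q0; apply: Q0; apply: eq_IZR.
  by apply/eqP; rewrite -normr_eq0 qE q0.
have p0 : (0 < p)%N.
  by rewrite lt0n; apply/eqP => p0; move: x0; rewrite xE p0 mul0r ltxx.
have g0 : (0 < gcdn p q)%N by rewrite gcdn_gt0 p0.
exists (p %/ gcdn p q)%N, (q %/ gcdn p q)%N; split.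
- by rewrite divn_gt0 // dvdn_leq ?dvdn_gcdl.
- by rewrite divn_gt0 // dvdn_leq ?dvdn_gcdr.
- by rewrite /coprime -(eqn_pmul2r g0) muln_gcdl !divnK ?dvdn_gcdl ?dvdn_gcdr // mul1n.
have gR : (gcdn p q)%:R != 0 :> R by rewrite pnatr_eq0 -lt0n.
have pG : p%:R = (p %/ gcdn p q)%:R * (gcdn p q)%:R :> R.
  by rewrite -natrM divnK ?dvdn_gcdl.
have qG : q%:R = (q %/ gcdn p q)%:R * (gcdn p q)%:R :> R.
  by rewrite -natrM divnK ?dvdn_gcdr.
by rewrite xE pG qG -mulf_div divff // mulr1.
Qed.

Lemma is_rational_nat_frac (p q : nat) : (0 < q)%N -> is_rational (p%:R / q%:R).
Proof.
move=> q0; exists (Z.of_nat p), (Z.of_nat q); split; first by lia.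
by rewrite RdivE -!INR_IZR_INZ !INRE.
Qed.

Lemma is_rationalM x y : is_rational x -> is_rational y -> is_rational (x * y)%R.
Proof.
move=> [p [q [q0 ->]]] [p' [q' [q0' ->]]].
exists (Z.mul p p'), (Z.mul q q'); split; first by move=> /Z.mul_eq_0 [].
by rewrite !mult_IZR !RmultE !RdivE mulf_div.
Qed.

Lemma is_rationalX x n : is_rational x -> is_rational (x ^+ n)%R.
Proof.
move=> rx; elim: n => [|n IH]; last by rewrite exprS; exact: is_rationalM.
rewrite expr0 (_ : 1 = 1%:R / 1%:R); first exact: is_rational_nat_frac.
by rewrite divr1.
Qed.

Lemma is_rationalV x : is_rational x -> x != 0 -> is_rational (x^-1)%R.
Proof.
move=> [p [q [q0 ->]]] x0; exists q, p; split; last by rewrite !RdivE invf_div.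
by move=> p0; move: x0; rewrite p0 RdivE mul0r eqxx.
Qed.

(** The exponent is c0 = k ln A, nonzero because A is not 1: exp c0 = A^k and exp (c0 h) = (A^h)^k =
    h^k. A coincidence of grid points with different j would give h as a quotient of integers. *)
Lemma rational_of_Rpower_fixpoint (A h : R) (k : nat) :
  (0 < k)%N -> 0 < A -> A != 1 -> is_rational (A ^+ k)%R -> h = Rpower A h ->
  is_algebraic h -> is_rational h.
Proof.
move=> k0 A0 A1 rA hA /algebraic_root[p p0 rp].
have h0 : 0 < h by rewrite hA; apply/RltP/exp_pos.
apply: NNPP => irr.
have [a [b [a0 b0 _ AE]]] := is_rational_pos rA (exprn_gt0 k A0).
pose c0 := (k%:R * ln A)%R.
have ec : exp c0 = A ^+ k by rewrite exp_natM exp_ln //; apply/RltP.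
apply: (@gelfond_schneider_contradiction h c0 a b k p) => //.
- apply/eqP => c00; move: ec; rewrite c00 expR0 => /eqP; rewrite eq_sym.
  by rewrite pexpr_eq1 ?(ltW A0) // (negPf A1).
- by rewrite ec.
- rewrite -[c0 * h]mulrA exp_natM; congr (_ ^+ _).
  by rewrite mulrC [RHS]hA.
move=> i j i' j' /eqP H; apply/eqP; apply: contraT => jj'; case: irr.
have hE : h = (IZR (Z.sub (Z.of_nat i') (Z.of_nat i)) / IZR (Z.sub (Z.of_nat j) (Z.of_nat j')))%R.
  rewrite !minus_IZR -!INR_IZR_INZ !INRE !RminusE.
  have d0 : j%:R - j'%:R != 0 :> R by rewrite subr_eq0 eqr_nat.
  apply: (mulIf d0); rewrite divfK //; move/eqP: H => H.
  apply/eqP; rewrite mulrBr subr_eq; apply/eqP; move: H.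
  by rewrite ![h * _]mulrC => H; lra.
by exists (Z.sub (Z.of_nat i') (Z.of_nat i)), (Z.sub (Z.of_nat j) (Z.of_nat j')); split=> //; lia.
Qed.

(** * Orders of roots of rationals *)

(** With a n = b t + 1, m (m^b)^t = m^(a n) = (p^a)^t, so m is the t-th power of p^a / m^b, and the
    divisibility of t-th powers makes this quotient an integer. *)
Lemma perfect_power_of_coprime_exponents (p m n t : nat) :
  (0 < n)%N -> (0 < t)%N -> (0 < m)%N -> coprime n t -> (p ^ t = m ^ n)%N ->
  exists u : nat, (m = u ^ t)%N.
Proof.
move=> n0 t0 m0 /eqP co eq_pm; case: (egcdnP t n0) => a b ab _.
have mb0 : (0 < m ^ b)%N by rewrite expn_gt0 m0.
have E : (m * (m ^ b) ^ t = (p ^ a) ^ t)%N.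
  by rewrite -expnM -expnS -[RHS]expnM [(a * t)%N]mulnC expnM eq_pm -expnM [(n * a)%N]mulnC ab co addn1.
have /dvdnP[u uE] : (m ^ b %| p ^ a)%N by rewrite -(dvdn_pexp2r _ _ t0) -E dvdn_mull.
have mbt : (0 < (m ^ b) ^ t)%N by rewrite expn_gt0 mb0.
by exists u; apply/eqP; rewrite -(eqn_pmul2r mbt) E uE expnMn.
Qed.

(** A prime factor p of u satisfies p^(t-1) <= t, which leaves t <= 2. For t = 2 it gives p = 2 and
    k = 2 w^2, hence k = 2: the equation 2 * 2 = 2^2 is why k >= 3 is required. *)
Lemma squarefree_mul_eq_expn (k t u : nat) : (forall p, prime p -> ~~ (p ^ 2 %| k)%N) ->
  (3 <= k)%N -> (0 < t)%N -> (k * t = u ^ t)%N -> t = 1%N.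
Proof.
move=> sqf k3 t0 ktu; have k0 : (0 < k)%N by apply: leq_trans k3.
have u2 : (1 < u)%N.
  rewrite ltnNge; apply/negP => u1; have : (k * t <= 1)%N.
    by rewrite ktu -(exp1n t) leq_exp2r.
  by rewrite leqNgt (leq_trans (ltnW k3)) // leq_pmulr.
have pr := pdiv_prime u2; have pu := pdiv_dvd u; set p := pdiv u in pr pu.
have lk : (logn p k <= 1)%N by have := sqf p pr; rewrite pfactor_dvdn // -ltnNge.
(* p^t divides k t while p^2 does not divide k, hence p^(t-1) divides t *)
have lt : (t.-1 <= logn p t)%N.
  have : (t <= logn p (k * t))%N.
    by rewrite ktu lognX leq_pmulr // logn_gt0 mem_primes pr pu (ltnW u2).
  by rewrite lognM //; lia.
have pt : (p ^ t.-1 <= t)%N.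
  apply: (@leq_trans (p ^ logn p t)%N); first by rewrite leq_exp2l ?prime_gt1.
  by rewrite dvdn_leq // pfactor_dvdnn.
have pt2 : (2 ^ t.-1 <= t)%N.
  by apply: leq_trans pt; case: (t.-1) => // y; rewrite leq_exp2r // prime_gt1.
case: t t0 ktu lt pt pt2 => [|[|[|t]]] //= _ ktu lt pt pt2.
  move: lt; rewrite logn_gt0 mem_primes pr /= => p2.
  have p2E : p = 2%N by apply/eqP; rewrite -(dvdn_prime2 pr).
  move: pu; rewrite p2E => /dvdnP[w wE].
  have kw : k = (2 * w ^ 2)%N by move: ktu; rewrite wE; lia.
  have [w1|w1] := leqP w 1; first by case: (w) w1 kw k3 => [|[|]] // _ ->.
  have := sqf _ (pdiv_prime w1); rewrite kw dvdn_mull // dvdn_exp2r //.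
  exact: pdiv_dvd.
suff : (t.+3 < 2 ^ t.+2)%N by rewrite ltnNge pt2.
by elim: t {ktu lt pt pt2} => // t IH; rewrite expnS mul2n -addnn; lia.
Qed.

Lemma prime_of_nat p : prime p -> Znumtheory.prime (Z.of_nat p).
Proof.
move=> pp; apply/prime_alt; split; first by have := prime_gt1 pp; lia.
move=> n [n1 np] [z zn]; have z0 : (Z.lt 0 z) by nia.
have pE : p = (Z.to_nat z * Z.to_nat n)%N by nia.
have /primeP[_ /(_ (Z.to_nat n))] := pp.
by rewrite {1}pE dvdn_mull // => /(_ isT)/orP[]/eqP; lia.
Qed.

Lemma squarefreeW k : squarefree k -> forall p, prime p -> ~~ (p ^ 2 %| k)%N.
Proof.
move=> sqf p pp; apply/negP => /dvdnP[z kE]; apply: (sqf _ (prime_of_nat pp)).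
by exists (Z.of_nat z); rewrite kE; lia.
Qed.

Lemma coprime_Nat_gcd a b : coprime a b <-> Nat.gcd a b = 1%N.
Proof.
have divP x y : Nat.divide x y <-> (x %| y)%N.
  by split=> [[z ->]|/dvdnP[z ->]]; [exact: dvdn_mull | exists z].
split=> [co|g1].
  apply/eqP; rewrite -dvdn1 -(eqP co) dvdn_gcd; apply/andP; split; apply/divP.
    exact: Nat.gcd_divide_l.
  exact: Nat.gcd_divide_r.
rewrite /coprime -dvdn1; apply/divP; rewrite -g1.
by apply: Nat.gcd_greatest; apply/divP; rewrite ?dvdn_gcdl ?dvdn_gcdr.
Qed.

Lemma frac_exp_eq (p q m n s t : nat) : (0 < q)%N -> (0 < n)%N ->
  coprime p q -> coprime m n ->
  (p%:R / q%:R) ^+ s = (m%:R / n%:R) ^+ t :> R -> (p ^ s = m ^ t)%N.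
Proof.
move=> q0 n0 pq mn; rewrite !expr_div_n => /eqP.
rewrite eqr_div ?expf_neq0 ?pnatr_eq0 -?lt0n // -!natrX -!natrM eqr_nat => /eqP E.
apply/eqP; rewrite eqn_dvd; apply/andP; split.
  rewrite -(@Gauss_dvdl _ _ (q ^ s)) ?coprimeXl ?coprimeXr // -E.
  exact: dvdn_mulr.
rewrite -(@Gauss_dvdl _ _ (n ^ t)) ?coprimeXl ?coprimeXr // E.
exact: dvdn_mulr.
Qed.

Lemma order_eq_numerator (A : R) (k m n : nat) :
  (3 <= k)%N -> squarefree k -> ord_eq A k -> 0 < A -> (0 < m)%N -> (0 < n)%N ->
  coprime m n -> A ^+ m = (m%:R / n%:R) ^+ n -> m = k.
Proof.
move=> k3 sqf [_ [rk min_k]] A0 m0 n0 mn Am.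
have k0 : (0 < k)%N by apply: leq_trans k3.
rewrite RpowE in rk.
have rm : is_rational (A ^+ m) by rewrite Am; exact/is_rationalX/is_rational_nat_frac.
have /dvdnP[t mE] : (k %| m)%N.
  (* A nonzero remainder of m by k would be a smaller exponent at which A has a rational power. *)
  have E := divn_eq m k; rewrite /dvdn; apply/eqP/eqP; rewrite -leqn0 leqNgt; apply/negP => r0.
  have jk : (m %% k < k)%N by rewrite ltn_mod.
  case: (min_k (m %% k)%N (elimT ssrnat.leP r0) (elimT ssrnat.ltP jk)).
  rewrite RpowE.
  have -> : A ^+ (m %% k) = A ^+ m * ((A ^+ k) ^+ (m %/ k))^-1.
    rewrite {2}E exprD mulrAC [(_ * k)%N]mulnC exprM divff ?mul1r //.
    by rewrite !expf_neq0 // gt_eqF.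
  apply: is_rationalM => //; apply: is_rationalV; first exact: is_rationalX.
  by rewrite !expf_neq0 // gt_eqF.
have t0 : (0 < t)%N by move: m0; rewrite mE muln_gt0 => /andP[].
have [p [q [p0 q0 pq AE]]] := is_rational_pos rk (exprn_gt0 k A0).
have pm : (p ^ t = m ^ n)%N.
  by apply: (frac_exp_eq q0 n0 pq mn); rewrite -AE -Am -exprM mulnC -mE.
have nt : coprime n t.
  by rewrite coprime_sym; apply: coprime_dvdl mn; rewrite mE dvdn_mulr.
have [u mu] := perfect_power_of_coprime_exponents n0 t0 m0 nt pm.
have t1 : t = 1%N.
  by apply: (@squarefree_mul_eq_expn k t u (squarefreeW sqf)) => //; rewrite mulnC -mE.
by rewrite mE t1 mul1n.
Qed.

(** If A^j = p/q is reduced, comparing A^(j k) gives p^k = k^(s j). A single prime r dividing k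
    suffices: it divides k exactly once, so k v_r(p) = s j, and k divides j by coprimality. *)
Lemma ord_eq_root (A : R) (k s : nat) :
  (3 <= k)%N -> squarefree k -> 0 < A -> (0 < s)%N -> coprime s k ->
  A ^+ k = (k%:R / s%:R) ^+ s -> ord_eq A k.
Proof.
move=> k3 sqf A0 s0 sk Ak; have k0 : (0 < k)%N by apply: leq_trans k3.
split; first by apply/ssrnat.leP.
split; first by rewrite RpowE Ak; exact/is_rationalX/is_rational_nat_frac.
move=> j /ssrnat.leP j0 /ssrnat.ltP jk; rewrite RpowE => rj.
have [p [q [p0 q0 pq AE]]] := is_rational_pos rj (exprn_gt0 j A0).
have pk : (p ^ k = k ^ (s * j))%N.
  apply: (frac_exp_eq q0 s0 pq); first by rewrite coprime_sym.
  by rewrite -AE -exprM [(j * k)%N]mulnC exprM Ak -exprM.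
have pr := pdiv_prime (ltnW k3); set r := pdiv k in pr.
have lk : logn r k = 1%N.
  apply/eqP; rewrite eqn_leq logn_gt0 mem_primes pr k0 pdiv_dvd !andbT.
  by have := squarefreeW sqf pr; rewrite pfactor_dvdn // -ltnNge.
have := congr1 (logn r) pk; rewrite !lognX lk muln1 => E.
have : (k %| s * j)%N by rewrite -E dvdn_mulr.
rewrite Gauss_dvdr 1?coprime_sym // => /(dvdn_leq j0).
by rewrite leqNgt jk.
Qed.

Lemma algebraic_fixpoint_frac (A h : R) (k : nat) :
  le 3 k -> squarefree k -> Rlt 0 A -> h = Rpower A h -> is_algebraic h ->
  ord_eq A k ->
  exists s : nat, [/\ lt 0 s, Nat.gcd s k = 1%N & h = Rdiv (INR k) (INR s)].
Proof.
move=> /ssrnat.leP k3 sqf /RltP A0 hA alg ordA; have [_ [rk min_k]] := ordA.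
have A1 : A != 1.
  apply/eqP => A1; case: (min_k 1%N (elimT ssrnat.leP (leqnn 1)) (elimT ssrnat.ltP (ltnW k3))).
  by rewrite A1 RpowE expr1; exact: (is_rationalX 0 rk).
have h0 : 0 < h by rewrite hA; apply/RltP/exp_pos.
have k0 : (0 < k)%N by apply: leq_trans k3.
have rh : is_rational h.
  by apply: (rational_of_Rpower_fixpoint k0 A0 A1 _ hA alg); rewrite -RpowE.
have [m [n [m0 n0 mn hE]]] := is_rational_pos rh h0.
(* m = h n, so A^m = (A^h)^n = h^n. *)
have Am : A ^+ m = (m%:R / n%:R) ^+ n.
  rewrite -hE [in RHS]hA -exp_natM -[A in LHS](exp_ln A); last exact/RltP.
  rewrite -exp_natM; congr exp; rewrite RmultE mulrA; congr (_ * _).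
  by rewrite hE mulrCA divff ?mulr1 // pnatr_eq0 -lt0n.
have mk := order_eq_numerator k3 sqf ordA A0 m0 n0 mn Am.
exists n; split; first exact/ssrnat.ltP.
  by apply/coprime_Nat_gcd; rewrite coprime_sym -mk.
by rewrite hE RdivE !INRE mk.
Qed.

Lemma ord_eq_Rpower (A : R) (k s : nat) :
  le 3 k -> squarefree k -> lt 0 s -> Nat.gcd s k = 1%N ->
  A = Rpower (Rdiv (INR k) (INR s)) (Rdiv (INR s) (INR k)) -> ord_eq A k.
Proof.
move=> /ssrnat.leP k3 sqf /ssrnat.ltP s0 /coprime_Nat_gcd sk AE.
have k0 : (0 < k)%N by apply: leq_trans k3.
apply: (@ord_eq_root A k s) => //; first by rewrite AE; apply/RltP/exp_pos.
have ks0 : 0 < k%:R / s%:R :> R by rewrite divr_gt0 ?ltr0n.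
rewrite AE /Rpower -exp_natM !RdivE !INRE !RmultE mulrA mulrCA divff; last first.
  by rewrite pnatr_eq0 -lt0n.
by rewrite mulr1 exp_natM exp_ln //; apply/RltP.
Qed.

End GelfondSchneider.

Lemma is_algebraic_of_rational_pow (x : R) (n : nat) :
  is_rational (x ^ S n) -> is_algebraic x.
Proof.
  (* The polynomial q X^(n+1) - p. *)
  intros [p [q [Hq Hx]]]. exists ((- p)%Z :: repeat 0%Z n ++ (q :: nil)).
  split.
  - exists q. split; [|exact Hq].
    right. apply in_or_app. right. now left.
  - assert (E : forall y m c,
      zpoly_eval (repeat 0%Z m ++ (c :: nil)) y = IZR c * y ^ m).
    { intros y m c. unfold zpoly_eval.
      induction m as [|m IH]; simpl; [ring | rewrite IH; ring]. }
    change (IZR (- p) + x * zpoly_eval (repeat 0%Z n ++ (q :: nil)) x = 0).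
    rewrite E, opp_IZR.
    replace (x * (IZR q * x ^ n)) with (IZR q * x ^ S n) by (simpl; ring).
    rewrite Hx. field. now apply not_0_IZR.
Qed.

Theorem theorem2p2 (k : nat) (hk : (3 <= k)%nat) (hsf : squarefree k) :
  forall A : R,
    (is_algebraic A /\ exp (- exp 1) <= A <= exp (/ exp 1) /\
     (exists h : R, Un_cv (tower A) h /\ is_algebraic h) /\
     ord_eq A k)
    <->
    (exists s : nat,
        INR k / exp 1 <= INR s <= INR k * exp 1 /\
        Nat.gcd s k = 1%nat /\
        A = Rpower (INR k / INR s) (INR s / INR k)).
Proof.
  intros A. pose proof exp1_gt1 as He.
  assert (Hk0 : 0 < INR k) by (apply lt_0_INR; lia).
  assert (Hei : / exp 1 * exp 1 = 1) by (apply Rinv_l; lra).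
  assert (Hei0 : 0 < / exp 1) by (apply Rinv_0_lt_compat; lra).
  split.
  - intros [_ [[HA1 HA2] [[h [Hcv Halg]] Hord]]].
    assert (HA0 : 0 < A) by (pose proof (exp_pos (- exp 1)); lra).
    assert (Hl1 : - exp 1 <= ln A) by (rewrite <- (ln_exp (- exp 1)); apply ln_mono; [apply exp_pos | exact HA1]).
    assert (Hl2 : ln A <= / exp 1) by (rewrite <- (ln_exp (/ exp 1)); apply ln_mono; assumption).
    pose proof (tower_limit_fixpoint A h Hcv) as Hh.
    pose proof (tower_limit_le_e A h HA0 Hl2 Hcv) as Hhe.
    pose proof (fixpoint_ge_inv_e (ln A) h Hl1 Hh) as Heh.
    destruct (GelfondSchneider.algebraic_fixpoint_frac hk hsf HA0 Hh Halg Hord) as [s [Hs Hsk HhE]].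
    assert (Hs0 : 0 < INR s) by (apply lt_0_INR; lia).
    assert (Hhs : h * INR s = INR k) by (rewrite HhE; field; lra).
    exists s. repeat split; [| |exact Hsk|].
    + apply Rmult_le_reg_r with (exp 1); [lra|].
      replace (INR k / exp 1 * exp 1) with (INR k) by (field; lra). nra.
    + assert (/ exp 1 * exp 1 <= h * exp 1) by (apply Rmult_le_compat_r; lra). nra.
    + unfold Rpower. rewrite <- HhE. rewrite Hh at 1. rewrite ln_exp.
      rewrite <- (exp_ln A HA0) at 1. f_equal. rewrite <- Hhs. field.
      split; [|lra]. intros H0. rewrite H0 in Hhs. lra.
  - intros [s [[Hs1 Hs2] [Hsk HA]]].
    (* The value s = 0 is excluded by k / e <= s. *)
    assert (Hs0 : 0 < INR s).
    { apply Rlt_le_trans with (INR k / exp 1); [|exact Hs1].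
      apply Rmult_lt_0_compat; lra. }
    assert (Hs : (0 < s)%nat) by (apply INR_lt; exact Hs0).
    set (h := INR k / INR s).
    assert (Hh0 : 0 < h) by (apply Rdiv_lt_0_compat; assumption).
    assert (Hhs : h * INR s = INR k) by (unfold h; field; lra).
    assert (Hh1 : / exp 1 <= h).
    { apply Rmult_le_reg_r with (INR s * exp 1); [nra|].
      replace (/ exp 1 * (INR s * exp 1)) with (INR s) by (field; lra). nra. }
    assert (Hh2 : h <= exp 1).
    { apply Rmult_le_reg_r with (INR s); [lra|]. rewrite Hhs.
      apply Rmult_le_compat_r with (r := exp 1) in Hs1; [|lra].
      replace (INR k / exp 1 * exp 1) with (INR k) in Hs1 by (field; lra). lra. }
    assert (HA0 : 0 < A) by (rewrite HA; apply exp_pos).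
    assert (Hln : ln A = ln h / h).
    { rewrite HA. unfold Rpower. rewrite ln_exp. fold h. unfold h at 3. field. lra. }
    assert (HhA : h = exp (h * ln A)).
    { rewrite Hln. replace (h * (ln h / h)) with (ln h) by (field; lra).
      now rewrite exp_ln. }
    (* From h >= 1/e: ln h >= -1 >= - e * h. *)
    assert (Hl1 : - exp 1 <= ln A).
    { rewrite Hln. apply Rmult_le_reg_r with h; [lra|].
      replace (ln h / h * h) with (ln h) by (field; lra).
      assert (-1 <= ln h).
      { rewrite <- (ln_exp (-1)). apply ln_mono; [apply exp_pos|].
        replace (-1) with (- (1)) by lra. now rewrite exp_Ropp. }
      assert (/ exp 1 * exp 1 <= h * exp 1) by (apply Rmult_le_compat_r; lra). lra. }
    assert (Hl2 : ln A <= / exp 1).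
    { rewrite Hln. apply Rmult_le_reg_r with h; [lra|].
      replace (ln h / h * h) with (ln h) by (field; lra).
      rewrite Rmult_comm. now apply ln_le_div_e. }
    pose proof (GelfondSchneider.ord_eq_Rpower hk hsf Hs Hsk HA) as Hord.
    repeat split.
    + apply (is_algebraic_of_rational_pow A (k - 1)).
      replace (S (k - 1)) with k by lia. apply Hord.
    + rewrite <- (exp_ln A HA0). now apply exp_mono.
    + rewrite <- (exp_ln A HA0). now apply exp_mono.
    + exists h. split.
      * destruct (Rle_or_lt 1 A) as [H | H].
        -- now apply tower_cv_ge1.
        -- now apply tower_cv_lt1.
      * apply (is_algebraic_of_rational_pow h 0).
        exists (Z.of_nat k), (Z.of_nat s). split; [lia|].
        rewrite <- !INR_IZR_INZ. unfold h. simpl. ring.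
    + apply Hord.
    + apply Hord.
    + apply Hord.
Qed.
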